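(* Let $H$ be a subgroup of $S_3$, and let $\widetilde{H}_3=\sigma^{-1}(H)/[P_3,P_3]$. (a) Let $H=\{1\}$. Then $\widetilde{H}_3$ is isomorphic to the quotient $P_3/[P_3,P_3]$, which is isomorphic to $\mathbb{Z}^3$. The corresponding flat manifold is the $3$-torus. (b) Let $H=\langle(1,2)\rangle$. Then $\widetilde{H}_3$ is a Bieberbach group of dimension $3$ with holonomy group $\mathbb{Z}_2$. The corresponding flat Riemannian manifold is diffeomorphic to the non-orientable manifold $\mathscr{B}_2$ that appears in Wolf's classification of flat Riemannian $3$-manifolds. (c) Let $H=\langle(1,3,2)\rangle$. Then $\widetilde{H}_3$ is isomorphic to the semi-direct product $\mathbb{Z}^3\rtimes\mathbb{Z}_3$, where the action is given by the matrix $$\begin{pmatrix}0&0&1\\1&0&0\\0&1&0\end{pmatrix}$$ with respect to the basis $(A_{1,2},A_{2,3},A_{1,3})$ of $P_3/[P_3,P_3]$, this quotient being identified with $\mathbb{Z}^3$.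
   Context: $B_3=\langle\sigma_1,\sigma_2\mid\sigma_1\sigma_2\sigma_1=\sigma_2\sigma_1\sigma_2\rangle$ is the Artin braid group on $3$ strings, $\sigma\colon B_3\to S_3$ is the homomorphism with $\sigma(\sigma_i)=(i,i+1)$ (permutations are composed from left to right), $P_3=\ker\sigma$ is the pure braid group, and $[P_3,P_3]$ is its commutator subgroup. $A_{1,2}=\sigma_1^2$, $A_{2,3}=\sigma_2^2$, $A_{1,3}=\sigma_2\sigma_1^2\sigma_2^{-1}$; their cosets, denoted by the same symbols, form a basis of the free Abelian group $P_3/[P_3,P_3]$. A crystallographic group of dimension $d$ is a group isomorphic to a discrete and uniform (cocompact) subgroup of $\mathbb{R}^d\rtimes\operatorname{O}(d,\mathbb{R})$; equivalently, a group $\Pi$ with a short exact sequence $0\to\mathbb{Z}^d\to\Pi\to\Phi\to1$ where $\Phi$ is finite and acts faithfully on $\mathbb{Z}^d$ by conjugation; $\Phi$ is its holonomy group. A Bieberbach group is a torsion-free crystallographic group. To a Bieberbach group $\Pi$ there corresponds a closed flat Riemannian manifold, unique up to affine diffeomorphism, whose fundamental group is $\Pi$. $\mathscr{B}_2$ (J. Wolf, Spaces of Constant Curvature, Theorem 3.5.9 and Corollary 3.5.10) is the closed non-orientable flat $3$-manifold with holonomy group $\mathbb{Z}_2$ whose fundamental group is generated by a lattice $\langle t_1,t_2,t_3\rangle\cong\mathbb{Z}^3$ of translations together with an element $\varepsilon$ satisfying $\varepsilon^2=t_1$, $\varepsilon t_2\varepsilon^{-1}=t_2$, $\varepsilon t_3\varepsilon^{-1}=t_1t_2t_3^{-1}$;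 among the two closed non-orientable flat $3$-manifolds with holonomy $\mathbb{Z}_2$, it is the one with $H_1(\,\cdot\,;\mathbb{Z})\cong\mathbb{Z}^2$. *)

(* Defs.v *)
(* MathComp / MathComp-Analysis development. *)
From HB Require Import structures.
From mathcomp Require Import all_boot all_order all_algebra all_fingroup.
From mathcomp Require Import all_classical all_reals all_analysis.

Set Implicit Arguments.
Unset Strict Implicit.
Unset Printing Implicit Defensive.

Import Order.TTheory GRing.Theory Num.Theory GroupScope.
Import numFieldNormedType.Exports generic_quotient.

Local Open Scope classical_set_scope.
Local Open Scope group_scope.
Local Open Scope quotient_scope.

Section Subgroups.
Variable G : groupType.

Definition gen_subgroup (S : set G) : {pred G} :=
  fun x => `[< forall K : groupClosed G, {subset S <= K} -> x \in K >].

Lemma gen_subgroupP (S : set G) x :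
  reflect (forall K : groupClosed G, {subset S <= K} -> x \in K)
          (x \in gen_subgroup S).
Proof. exact: asboolP. Qed.

Lemma gen_subgroupM S : mulg_closed (gen_subgroup S).
Proof.
move=> x y /gen_subgroupP Sx /gen_subgroupP Sy; apply/gen_subgroupP => K SK.
by rewrite gpredM ?Sx ?Sy.
Qed.

Lemma gen_subgroup1 S : 1 \in gen_subgroup S.
Proof. by apply/gen_subgroupP => K _; exact: gpred1. Qed.

Lemma gen_subgroupV S : invg_closed (gen_subgroup S).
Proof.
by move=> x /gen_subgroupP Sx; apply/gen_subgroupP => K SK; rewrite gpredV Sx.
Qed.

HB.instance Definition _ S := isMulClosed.Build G (gen_subgroup S)
  (@gen_subgroupM S).
HB.instance Definition _ S := isMul1Closed.Build G (gen_subgroup S)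
  (gen_subgroup1 S).
HB.instance Definition _ S := isInvClosed.Build G (gen_subgroup S)
  (@gen_subgroupV S).

Definition commutator_subgroup (A : {pred G}) : {pred G} :=
  gen_subgroup [set z | exists x y, [/\ x \in A, y \in A & z = [~ x, y]]].

HB.instance Definition _ A := GroupClosed.on (commutator_subgroup A).

Definition torsion_free (A : {pred G}) : Prop :=
  forall x n, x \in A -> (0 < n)%N -> x ^+ n = 1 -> x = 1.

End Subgroups.

HB.mixin Record isNormalClosed (G : groupType) (S : {pred G}) := {
  gpredJr : forall x y : G, x \in S -> x ^ y \in S
}.

#[short(type="normalClosed")]
HB.structure Definition NormalClosed G :=
  {S of isNormalClosed G S & GroupClosed G S}.

Section CommutatorNormal.
Variables (G : groupType) (A : normalClosed G).

Lemma commutator_subgroupJ x y :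
  x \in commutator_subgroup A -> x ^ y \in commutator_subgroup A.
Proof.
pose K : {pred G} := fun z => z ^ y \in commutator_subgroup A.
have KE z : (z \in K) = (z ^ y \in commutator_subgroup A) by [].
have KM : mulg_closed K.
  by move=> u v; rewrite !KE conjMg => Ku Kv; exact: gpredM.
have K1 : 1 \in K by rewrite KE conj1g gpred1.
have KV : invg_closed K by move=> u; rewrite !KE conjVg gpredV.
pose mM := isMulClosed.Build G K KM.
pose m1 := isMul1Closed.Build G K K1.
pose mV := isInvClosed.Build G K KV.
pose KG : groupClosed G := HB.pack K mM m1 mV.
move=> /gen_subgroupP/(_ KG); apply=> _ /set_mem[u [v [Au Av ->]]].
rewrite [_ \in _]KE conjRg; apply/gen_subgroupP => L; apply; apply/mem_set.
by exists (u ^ y), (v ^ y); split => //; exact: gpredJr.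
Qed.

HB.instance Definition _ :=
  isNormalClosed.Build G (commutator_subgroup A) commutator_subgroupJ.

End CommutatorNormal.

Definition is_isomorphism (G H : groupType) (A : {pred G}) (B : {pred H})
    (f : G -> H) : Prop :=
  {in A &, {morph f : x y / x * y}} /\ set_bij [set` A] [set` B] f.

Definition isomorphic (G H : groupType) (A : {pred G}) (B : {pred H}) : Prop :=
  exists f : G -> H, is_isomorphism A B f.

Section Cosets.
Variables (G : groupType) (A : groupClosed G).

Definition same_coset (x y : G) : bool := x^-1 * y \in A.

Lemma same_coset_refl : reflexive same_coset.
Proof. by move=> x; rewrite /same_coset mulVg gpred1. Qed.

Lemma same_coset_sym : symmetric same_coset.
Proof. by move=> x y; rewrite /same_coset -gpredV invgM invgK. Qed.

Lemma same_coset_trans : transitive same_coset.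
Proof.
move=> y x z; rewrite /same_coset => xy yz.
by rewrite -[z](mulKVg y) mulgA gpredM.
Qed.

Canonical same_coset_equiv :=
  EquivRel same_coset same_coset_refl same_coset_sym same_coset_trans.

Definition cosets := {eq_quot same_coset}.

HB.instance Definition _ := Choice.on cosets.
HB.instance Definition _ := EqQuotient.on cosets.

End Cosets.

Section QuotientGroup.
Variables (G : groupType) (N : normalClosed G).

Definition quotg := cosets N.
HB.instance Definition _ := Choice.on quotg.
HB.instance Definition _ := EqQuotient.on quotg.

Definition qclass (x : G) : quotg := \pi x.

Lemma qclassP x y : qclass x = qclass y <-> x^-1 * y \in N.
Proof. by split=> [/eqmodP|H]; [|apply/eqmodP]. Qed.

Lemma qclass_repr q : qclass (repr q) = q.
Proof. exact: reprK. Qed.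

Lemma repr_qclass x : exists2 n, n \in N & repr (qclass x) = x * n.
Proof.
exists (x^-1 * repr (qclass x)); last by rewrite mulKVg.
by apply/qclassP; rewrite qclass_repr.
Qed.

Definition quot_mul (p q : quotg) := qclass (repr p * repr q).
Definition quot_inv (p : quotg) := qclass (repr p)^-1.

Lemma qclassM x y : qclass (x * y) = quot_mul (qclass x) (qclass y).
Proof.
apply/qclassP.
have [m Nm ->] := repr_qclass x; have [n Nn ->] := repr_qclass y.
have -> : (x * y)^-1 * (x * m * (y * n)) = m ^ y * n.
  by rewrite /conjg invgM !mulgA mulgVK.
by rewrite gpredM ?gpredJr.
Qed.

Lemma qclassV x : qclass x^-1 = quot_inv (qclass x).
Proof.
apply/qclassP; have [n Nn ->] := repr_qclass x.
have -> : x^-1^-1 * (x * n)^-1 = n^-1 ^ x^-1.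
  by rewrite /conjg invgM invgK.
by rewrite gpredJr ?gpredV.
Qed.

Fact quot_mulA : associative quot_mul.
Proof.
move=> p q r; rewrite -(qclass_repr p) -(qclass_repr q) -(qclass_repr r).
by rewrite -!qclassM mulgA.
Qed.
Fact quot_mul1 : left_id (qclass 1) quot_mul.
Proof. by move=> p; rewrite -(qclass_repr p) -qclassM mul1g. Qed.
Fact quot_1mul : right_id (qclass 1) quot_mul.
Proof. by move=> p; rewrite -(qclass_repr p) -qclassM mulg1. Qed.
Fact quot_mulV : left_inverse (qclass 1) quot_inv quot_mul.
Proof.
by move=> p; rewrite -(qclass_repr p) -qclassV -qclassM mulVg.
Qed.
Fact quot_Vmul : right_inverse (qclass 1) quot_inv quot_mul.
Proof.
by move=> p; rewrite -(qclass_repr p) -qclassV -qclassM mulgV.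
Qed.

HB.instance Definition _ := isGroup.Build quotg
  quot_mulA quot_mul1 quot_1mul quot_mulV quot_Vmul.

End QuotientGroup.

(* When [N] is contained in [A], this is [A / N], seen inside [G / N]. *)
Definition quotient_subgroup (G : groupType) (A : {pred G})
    (N : normalClosed G) : {pred quotg N} :=
  fun q => `[< exists2 x, x \in A & q = qclass N x >].

Arguments quotient_subgroup {G} A N.

(* [(x, true)] is the letter [x] and [(x, false)] its formal inverse. *)
Definition word (X : Type) := seq (X * bool).

Definition word_inv (X : Type) (w : word X) : word X :=
  rev [seq (l.1, ~~ l.2) | l <- w].

Inductive word_cong (X : Type) (rels : word X -> word X -> Prop) :
    word X -> word X -> Prop :=
| wc_refl u : word_cong rels u u
| wc_sym u v : word_cong rels u v -> word_cong rels v u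
| wc_trans u v w :
    word_cong rels u v -> word_cong rels v w -> word_cong rels u w
| wc_cat u u' v v' : word_cong rels u u' -> word_cong rels v v' ->
    word_cong rels (u ++ v) (u' ++ v')
| wc_cancel x b : word_cong rels [:: (x, b); (x, ~~ b)] [::]
| wc_rel u v : rels u v -> word_cong rels u v.

Section Presented.
Variables (X : choiceType) (rels : word X -> word X -> Prop).

Definition word_eq (u v : word X) : bool := `[< word_cong rels u v >].

Lemma word_eq_refl : reflexive word_eq.
Proof. by move=> u; apply/asboolP; exact: wc_refl. Qed.
Lemma word_eq_sym : symmetric word_eq.
Proof. by move=> u v; apply/asboolP/asboolP => /wc_sym. Qed.
Lemma word_eq_trans : transitive word_eq.
Proof.
by move=> v u w /asboolP uv /asboolP vw; apply/asboolP; exact: wc_trans uv vw.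
Qed.

Canonical word_eq_equiv :=
  EquivRel word_eq word_eq_refl word_eq_sym word_eq_trans.

Definition presented := {eq_quot word_eq}.
HB.instance Definition _ := Choice.on presented.
HB.instance Definition _ := EqQuotient.on presented.

Definition of_word (w : word X) : presented := \pi w.

Lemma of_wordP u v : of_word u = of_word v <-> word_cong rels u v.
Proof. by split=> [/eqmodP/asboolP|H]; [|apply/eqmodP/asboolP]. Qed.

Lemma of_word_repr g : of_word (repr g) = g.
Proof. exact: reprK. Qed.

Lemma repr_of_word w : word_cong rels (repr (of_word w)) w.
Proof. by apply/of_wordP; rewrite of_word_repr. Qed.

Lemma wc_invl w : word_cong rels (word_inv w ++ w) [::].
Proof.
elim: w => [|[x b] w IH]; first exact: wc_refl.
rewrite /word_inv /= rev_cons -cats1 -catA /=.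
apply: wc_trans IH; apply: wc_cat; first exact: wc_refl.
apply: (@wc_cat _ _ [:: (x, ~~ b); (x, b)] [::] w w); last exact: wc_refl.
by have := @wc_cancel _ rels x (~~ b); rewrite negbK.
Qed.

Lemma word_invK w : word_inv (word_inv w) = w :> word X.
Proof.
rewrite /word_inv map_rev revK -map_comp -[RHS]map_id.
by apply: eq_map => -[x b] /=; rewrite negbK.
Qed.

Lemma wc_inv u v : word_cong rels u v ->
  word_cong rels (word_inv u) (word_inv v).
Proof.
move=> uv.
have := wc_invl v; have := wc_invl (word_inv u).
rewrite word_invK => uVu Vvv.
apply: (@wc_trans _ _ _ ([::] ++ word_inv u)); first exact: wc_refl.
apply: (wc_trans (wc_cat (wc_sym Vvv) (wc_refl _ _))).
rewrite -catA -[X in word_cong _ _ X]cats0.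
apply: wc_cat; first exact: wc_refl.
apply: wc_trans uVu.
by apply: wc_cat; [exact: wc_sym|exact: wc_refl].
Qed.

Definition pres_mul (g h : presented) := of_word (repr g ++ repr h).
Definition pres_inv (g : presented) := of_word (word_inv (repr g)).

Lemma of_wordM u v : of_word (u ++ v) = pres_mul (of_word u) (of_word v).
Proof.
by apply/of_wordP; apply: wc_cat; apply: wc_sym; exact: repr_of_word.
Qed.

Lemma of_wordV u : of_word (word_inv u) = pres_inv (of_word u).
Proof. by apply/of_wordP; apply: wc_inv; apply: wc_sym; exact: repr_of_word. Qed.

Fact pres_mulA : associative pres_mul.
Proof.
move=> g h k; rewrite -(of_word_repr g) -(of_word_repr h) -(of_word_repr k).
by rewrite -!of_wordM catA.
Qed.
Fact pres_mul1 : left_id (of_word [::]) pres_mul.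
Proof. by move=> g; rewrite -(of_word_repr g) -of_wordM. Qed.
Fact pres_1mul : right_id (of_word [::]) pres_mul.
Proof. by move=> g; rewrite -(of_word_repr g) -of_wordM cats0. Qed.
Fact pres_mulV : left_inverse (of_word [::]) pres_inv pres_mul.
Proof.
move=> g; rewrite -(of_word_repr g) -of_wordV -of_wordM.
by apply/of_wordP; exact: wc_invl.
Qed.
Fact pres_Vmul : right_inverse (of_word [::]) pres_inv pres_mul.
Proof.
move=> g; rewrite -(of_word_repr g) -of_wordV -of_wordM.
by apply/of_wordP; rewrite -{1}(word_invK (repr g)); exact: wc_invl.
Qed.

HB.instance Definition _ := isGroup.Build presented
  pres_mulA pres_mul1 pres_1mul pres_mulV pres_Vmul.

Lemma of_word_cat u v : of_word (u ++ v) = of_word u * of_word v.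
Proof. exact: of_wordM. Qed.

Definition pres_gen (x : X) : presented := of_word [:: (x, true)].

Variables (H : groupType) (f : X -> H).

Definition eval_word (w : word X) : H :=
  \prod_(l <- w) (if l.2 then f l.1 else (f l.1)^-1).

Definition pres_lift (g : presented) : H := eval_word (repr g).

Hypothesis f_rels : forall u v, rels u v -> eval_word u = eval_word v.

Lemma eval_word_cong u v : word_cong rels u v -> eval_word u = eval_word v.
Proof.
elim=> //.
- by move=> ? ? ? _ -> _ ->.
- by move=> ? ? ? ? _ + _; rewrite /eval_word !big_cat /= => -> ->.
- move=> x [|]; rewrite /eval_word !big_cons !big_nil /= mulg1.
    by rewrite mulgV.
  by rewrite mulVg.
Qed.

Lemma pres_lift_word w : pres_lift (of_word w) = eval_word w.
Proof. exact/eval_word_cong/repr_of_word. Qed.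

Lemma pres_liftM : {morph pres_lift : g h / g * h}.
Proof.
move=> g h; rewrite -(of_word_repr g) -(of_word_repr h).
by rewrite -of_word_cat !pres_lift_word /eval_word big_cat.
Qed.

Lemma pres_lift_gen x : pres_lift (pres_gen x) = f x.
Proof. by rewrite pres_lift_word /eval_word big_seq1. Qed.

End Presented.

Definition letter (i : 'I_2) : word 'I_2 := [:: (i, true)].

Inductive braid_rel : word 'I_2 -> word 'I_2 -> Prop :=
| BraidRel : braid_rel
    (letter ord0 ++ letter ord_max ++ letter ord0)
    (letter ord_max ++ letter ord0 ++ letter ord_max).

Definition B3 := presented braid_rel.
HB.instance Definition _ := Group.on B3.

Definition s1 : B3 := pres_gen braid_rel ord0.
Definition s2 : B3 := pres_gen braid_rel ord_max.

Lemma braid_relation : s1 * s2 * s1 = s2 * s1 * s2.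
Proof.
rewrite -!mulgA.
have /of_wordP := wc_rel BraidRel.
by rewrite !of_word_cat.
Qed.

(* Strings are numbered from 0: the [i]-th generator goes to [(i, i+1)].
   Products in ['S_3] are composed from left to right. *)
Definition transp (i : 'I_2) : 'S_3 :=
  tperm (widen_ord (leqnSn 2) i) (lift ord0 i).

Definition sigma : B3 -> 'S_3 := @pres_lift _ braid_rel 'S_3 transp.

Lemma transp_rel u v :
  braid_rel u v -> eval_word transp u = eval_word transp v.
Proof.
case; rewrite /eval_word !big_cons !big_nil /= !mulg1 /transp.
apply/permP => i; rewrite !permM /=.
have e0 : widen_ord (leqnSn 2) (ord0 : 'I_2) = 0%R :> 'I_3 by exact: val_inj.
have e1 : lift ord0 (ord0 : 'I_2) = 1%R :> 'I_3 by exact: val_inj.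
have e2 : widen_ord (leqnSn 2) (ord_max : 'I_2) = 1%R :> 'I_3 by exact: val_inj.
have e3 : lift ord0 (ord_max : 'I_2) = 2%R :> 'I_3 by exact: val_inj.
rewrite e0 e1 e2 e3.
by case: i => [[|[|[|//]]] Hi]; rewrite !permE /=; apply/eqP.
Qed.

Lemma sigmaM : {morph sigma : x y / x * y}.
Proof. exact: pres_liftM transp_rel. Qed.

Lemma sigma1 : sigma 1 = 1.
Proof. by apply: (@mulgI _ (sigma 1)); rewrite -sigmaM !mulg1. Qed.

Lemma sigmaV x : sigma x^-1 = (sigma x)^-1.
Proof. by apply: (@mulgI _ (sigma x)); rewrite -sigmaM !mulgV sigma1. Qed.

Definition sigma_preim (H : {group 'S_3}) : {pred B3} := fun x => sigma x \in H.

Definition P3 : {pred B3} := fun x => sigma x == 1.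

Lemma P3E x : (x \in P3) = (sigma x == 1). Proof. by []. Qed.
Fact P3M : mulg_closed P3.
Proof.
by move=> x y; rewrite !P3E sigmaM => /eqP -> /eqP ->; rewrite mulg1.
Qed.
Fact P31 : 1 \in P3. Proof. by rewrite P3E sigma1. Qed.
Fact P3V : invg_closed P3.
Proof. by move=> x; rewrite !P3E sigmaV => /eqP ->; rewrite invg1. Qed.
Fact P3J x y : x \in P3 -> x ^ y \in P3.
Proof.
by rewrite !P3E /conjg !sigmaM sigmaV => /eqP ->; rewrite mul1g mulVg.
Qed.

HB.instance Definition _ := isMulClosed.Build B3 P3 P3M.
HB.instance Definition _ := isMul1Closed.Build B3 P3 P31.
HB.instance Definition _ := isInvClosed.Build B3 P3 P3V.
HB.instance Definition _ := isNormalClosed.Build B3 P3 P3J.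

Notation P3' := (commutator_subgroup P3 : normalClosed B3).

Definition B3Q := quotg P3'.
HB.instance Definition _ := Group.on B3Q.

Definition P3Q : {pred B3Q} := quotient_subgroup P3 P3'.

Definition Htilde (H : {group 'S_3}) : {pred B3Q} :=
  quotient_subgroup (sigma_preim H) P3'.

Definition A12 : B3Q := qclass P3' (s1 ^+ 2).
Definition A23 : B3Q := qclass P3' (s2 ^+ 2).
Definition A13 : B3Q := qclass P3' (s2 * s1 ^+ 2 * s2^-1).

Section Isometries.
Variables (R : realType) (d : nat).
Local Open Scope ring_scope.

(* The element [(v, A)] of R^d x| O(d), i.e. the isometry [x |-> A x + v]. *)
Record eisom := Isom {
  eisom_val :> 'cV[R]_d * 'M[R]_d;
  _ : eisom_val.2^T *m eisom_val.2 == 1%:M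
}.

HB.instance Definition _ := [isSub for eisom_val].
HB.instance Definition _ := [Choice of eisom by <:].

Definition tr (g : eisom) : 'cV[R]_d := (eisom_val g).1.
Definition lin (g : eisom) : 'M[R]_d := (eisom_val g).2.

Lemma lin_orth g : (lin g)^T *m lin g = 1%:M.
Proof. by case: g => p pP; exact/eqP. Qed.

Lemma lin_orthC g : lin g *m (lin g)^T = 1%:M.
Proof. exact/mulmx1C/lin_orth. Qed.

Lemma eisomP g h : tr g = tr h -> lin g = lin h -> g = h.
Proof.
move=> e1 e2; apply: val_inj => /=; move: e1 e2; rewrite /tr /lin.
by case: (eisom_val g) (eisom_val h) => [? ?] [? ?] /= -> ->.
Qed.

Fact eisom_one_subproof : ((0, 1%:M) : 'cV[R]_d * 'M[R]_d).2^T *m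
  ((0, 1%:M) : 'cV[R]_d * 'M[R]_d).2 == 1%:M.
Proof. by rewrite /= trmx1 mul1mx. Qed.
Definition eisom_one := Isom eisom_one_subproof.

Fact eisom_mul_subproof g h :
  let p := (tr g + lin g *m tr h, lin g *m lin h) in p.2^T *m p.2 == 1%:M.
Proof.
by rewrite /= trmx_mul mulmxA -(mulmxA _ (lin g)^T) lin_orth mulmx1 lin_orth.
Qed.
Definition eisom_mul g h := Isom (eisom_mul_subproof g h).

Fact eisom_inv_subproof g :
  let p := (- ((lin g)^T *m tr g), (lin g)^T) in p.2^T *m p.2 == 1%:M.
Proof. by rewrite /= trmxK lin_orthC. Qed.
Definition eisom_inv g := Isom (eisom_inv_subproof g).

Fact eisom_mulA : associative eisom_mul.
Proof.
move=> g h k; apply: eisomP; rewrite /tr /lin /=; last by rewrite mulmxA.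
by rewrite mulmxDr addrA mulmxA.
Qed.
Fact eisom_mul1 : left_id eisom_one eisom_mul.
Proof. by move=> g; apply: eisomP; rewrite /tr /lin /= mul1mx ?add0r. Qed.
Fact eisom_1mul : right_id eisom_one eisom_mul.
Proof.
by move=> g; apply: eisomP; rewrite /tr /lin /= ?mulmx1 ?mulmx0 ?addr0.
Qed.
Fact eisom_mulV : left_inverse eisom_one eisom_inv eisom_mul.
Proof.
move=> g; apply: eisomP; rewrite /tr /lin /=; first by rewrite addNr.
exact: lin_orth.
Qed.
Fact eisom_Vmul : right_inverse eisom_one eisom_inv eisom_mul.
Proof.
move=> g; apply: eisomP; rewrite /tr /lin /=; last exact: lin_orthC.
by rewrite mulmxN mulmxA lin_orthC mul1mx subrr.
Qed.

HB.instance Definition _ := isGroup.Build eisom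
  eisom_mulA eisom_mul1 eisom_1mul eisom_mulV eisom_Vmul.

HB.instance Definition _ := Topological.copy eisom (initial_topology eisom_val).

Definition eact (g : eisom) (x : 'cV[R]_d) : 'cV[R]_d := lin g *m x + tr g.

Lemma eact1 x : eact 1%g x = x.
Proof. by rewrite /eact /lin /tr /= mul1mx addr0. Qed.

Lemma eactM g h x : eact (g * h)%g x = eact g (eact h x).
Proof.
by rewrite /eact /lin /tr /= mulmxDr mulmxA -addrA [_ + (eisom_val g).1]addrC.
Qed.

Fact transl_subproof (v : 'cV[R]_d) :
  let p := (v, 1%:M : 'M[R]_d) in p.2^T *m p.2 == 1%:M.
Proof. by rewrite /= trmx1 mul1mx. Qed.
Definition transl v := Isom (transl_subproof v).

Definition discrete_subgroup (Gam : groupClosed eisom) : Prop :=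
  forall g, g \in Gam -> isolated [set` Gam] g.

Definition uniform_subgroup (Gam : groupClosed eisom) : Prop :=
  compact [set: quotient_topology (cosets Gam)].

Definition crystallographic (G : groupType) (A : {pred G}) : Prop :=
  exists Gam : groupClosed eisom,
    [/\ discrete_subgroup Gam, uniform_subgroup Gam & isomorphic A Gam].

Definition bieberbach (G : groupType) (A : {pred G}) : Prop :=
  crystallographic A /\ torsion_free A.

(* [Gam] acts freely, properly and cocompactly on R^d, so that the orbit space
   R^d / Gam is a closed flat manifold with fundamental group [Gam]. *)
Definition flat_manifold_group (Gam : groupClosed eisom) : Prop :=
  [/\ discrete_subgroup Gam, uniform_subgroup Gam & torsion_free Gam].

Definition flat_manifold_with_pi1 (G : groupType) (A : {pred G})
    (Gam : groupClosed eisom) : Prop :=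
  flat_manifold_group Gam /\ isomorphic A Gam.

Section OrbitSpace.
Variable Gam : groupClosed eisom.

Definition same_orbit (x y : 'cV[R]_d) : bool :=
  `[< exists2 g, g \in Gam & eact g x = y >].

Lemma same_orbit_refl : reflexive same_orbit.
Proof. by move=> x; apply/asboolP; exists 1%g; rewrite ?gpred1 ?eact1. Qed.

Lemma same_orbit_sym : symmetric same_orbit.
Proof.
move=> x y; apply/asboolP/asboolP => -[g Gg <-]; exists g^-1%g;
  by rewrite ?gpredV // -eactM mulVg eact1.
Qed.

Lemma same_orbit_trans : transitive same_orbit.
Proof.
move=> y x z /asboolP[g Gg <-] /asboolP[h Gh <-]; apply/asboolP.
by exists (h * g)%g; rewrite ?eactM // gpredM.
Qed.

Canonical same_orbit_equiv :=
  EquivRel same_orbit same_orbit_refl same_orbit_sym same_orbit_trans.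

Definition orbit_space := quotient_topology {eq_quot same_orbit}.
HB.instance Definition _ := Topological.on orbit_space.
HB.instance Definition _ := Quotient.on orbit_space.

Definition orbit_class (x : 'cV[R]_d) : orbit_space := \pi x.

(* The manifold R^d / Gam is orientable iff Gam preserves the orientation
   of R^d. *)
Definition orientable : Prop := forall g, g \in Gam -> 0 < \det (lin g).

End OrbitSpace.

End Isometries.

Section Smooth.
Variables (R : realType) (V W : normedModType R).

Fixpoint Ck_on (k : nat) (U : set V) (f : V -> W) : Prop :=
  match k with
  | 0 => forall x, U x -> {for x, continuous f}
  | k'.+1 => (forall x, U x -> differentiable f x) /\
             (forall v, Ck_on k' U ('D_v f))
  end.

Definition smooth_on (U : set V) (f : V -> W) : Prop := forall k, Ck_on k U f.

End Smooth.

(* The projection R^d -> R^d / Gam is a local diffeomorphism, so that a map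
   between such quotients is smooth iff it locally lifts to smooth maps. *)
Definition smooth_map (R : realType) (d : nat) (Gam Gam' : groupClosed (eisom R d))
    (F : orbit_space Gam -> orbit_space Gam') : Prop :=
  forall x : 'cV[R]_d, exists (U : set 'cV[R]_d) (f : 'cV[R]_d -> 'cV[R]_d),
    [/\ open U, U x, smooth_on U f &
        forall y, U y -> F (orbit_class Gam y) = orbit_class Gam' (f y)].

Definition diffeomorphic (R : realType) (d : nat)
    (Gam Gam' : groupClosed (eisom R d)) : Prop :=
  exists (F : orbit_space Gam -> orbit_space Gam')
         (F' : orbit_space Gam' -> orbit_space Gam),
    [/\ cancel F F', cancel F' F, smooth_map F & smooth_map F'].

(* The infinite free abelian group Z^d, written multiplicatively. *)
Definition Zlattice (d : nat) := Algebra.to_multiplicative 'cV[int]_d.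
HB.instance Definition _ d := Group.on (Zlattice d).

(* An extension 0 -> Z^d -> A -> Phi -> 1 with Phi finite acting faithfully on
   Z^d by conjugation. *)
Definition has_holonomy (d : nat) (G : groupType) (A : {pred G})
    (Phi : finGroupType) : Prop :=
  exists (i : Zlattice d -> G) (p : G -> Phi),
    [/\ injective i /\ {morph i : u v / u * v},
        {in A &, {morph p : x y / x * y}},
        forall c : Phi, exists2 x, x \in A & p x = c,
        forall x, x \in A /\ p x = 1 <-> exists u, x = i u &
        forall x, x \in A -> (forall u, x * i u * x^-1 = i u) -> p x = 1].

Section Torus.
Variables (R : realType) (d : nat).
Local Open Scope ring_scope.

Definition torus_group : {pred eisom R d} :=
  fun g => (lin g == 1%:M) && [forall i, tr g i 0 \is a Num.int].

Lemma torus_groupP (g : eisom R d) :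
  reflect (lin g = 1%:M /\ forall i, tr g i 0 \is a Num.int)
          (g \in torus_group).
Proof.
apply: (iffP andP) => -[g1 gZ]; split; first exact/eqP; first exact/forallP.
  by apply/eqP.
by apply/forallP.
Qed.

Fact torus_groupM : mulg_closed torus_group.
Proof.
move=> g h /torus_groupP[g1 gZ] /torus_groupP[h1 hZ]; apply/torus_groupP.
split; first by rewrite [LHS](_ : _ = lin g *m lin h)// g1 h1 mulmx1.
move=> i; rewrite (_ : tr _ = tr g + lin g *m tr h)// g1 mul1mx mxE.
by rewrite rpredD.
Qed.
Fact torus_group1 : 1%g \in torus_group.
Proof.
apply/torus_groupP; split=> // i.
by rewrite (_ : tr _ = 0)// mxE rpred0.
Qed.
Fact torus_groupV : invg_closed torus_group.
Proof.
move=> g /torus_groupP[g1 gZ]; apply/torus_groupP.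
split; first by rewrite [LHS](_ : _ = (lin g)^T)// g1 trmx1.
move=> i; rewrite (_ : tr _ = - ((lin g)^T *m tr g))// g1 trmx1 mul1mx mxE.
by rewrite rpredN.
Qed.

HB.instance Definition _ :=
  isMulClosed.Build (eisom R d) torus_group torus_groupM.
HB.instance Definition _ :=
  isMul1Closed.Build (eisom R d) torus_group torus_group1.
HB.instance Definition _ :=
  isInvClosed.Build (eisom R d) torus_group torus_groupV.

End Torus.

Arguments torus_group : clear implicits.

(* [a] collects in columns the translation vectors of t_1, t_2, t_3; the
   relations are those of J. Wolf, Spaces of Constant Curvature, Thm 3.5.9.
   They determine the quotient manifold up to affine diffeomorphism only. *)
Definition is_wolf_B2 (R : realType) (Gam : groupClosed (eisom R 3)) : Prop :=
  [/\ flat_manifold_group Gam, ~ orientable Gam, has_holonomy 3 Gam 'Z_2 &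
      exists (a : 'M[R]_3) (e : eisom R 3),
        let t1 := transl (col 0%R a) in
        let t2 := transl (col 1%R a) in
        let t3 := transl (col 2%R a) in
        [/\ a \in unitmx,
            Gam =i gen_subgroup [set t1; t2; t3; e],
            e ^+ 2 = t1,
            e * t2 * e^-1 = t2 &
            e * t3 * e^-1 = t1 * t2 * t3^-1]].

Record group_action (N K : groupType) := GroupAction {
  gaction :> K -> N -> N;
  gaction1 : forall n, gaction 1 n = n;
  gactionM : forall k l n, gaction (k * l) n = gaction k (gaction l n);
  gaction_morph : forall k, {morph gaction k : m n / m * n}
}.

Definition semidirect (N K : groupType) (theta : group_action N K) : Type :=
  (N * K)%type.

Section SemidirectProduct.
Variables (N K : groupType) (theta : group_action N K).
Local Notation sdprod_type := (semidirect theta).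

HB.instance Definition _ := Choice.on sdprod_type.

Definition sd_one : sdprod_type := (1, 1).
Definition sd_mul (x y : sdprod_type) : sdprod_type :=
  (x.1 * theta x.2 y.1, x.2 * y.2).
Definition sd_inv (x : sdprod_type) : sdprod_type :=
  (theta x.2^-1 x.1^-1, x.2^-1).

Lemma theta1 k : theta k 1 = 1.
Proof. by apply: (@mulgI _ (theta k 1)); rewrite -gaction_morph !mulg1. Qed.

Fact sd_mulA : associative sd_mul.
Proof.
move=> [m k] [n l] [p j]; rewrite /sd_mul /=.
by rewrite gaction_morph gactionM !mulgA.
Qed.
Fact sd_mul1 : left_id sd_one sd_mul.
Proof. by move=> [m k]; rewrite /sd_mul /= gaction1 !mul1g. Qed.
Fact sd_1mul : right_id sd_one sd_mul.
Proof. by move=> [m k]; rewrite /sd_mul /= theta1 !mulg1. Qed.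
Fact sd_mulV : left_inverse sd_one sd_inv sd_mul.
Proof.
by move=> [m k]; rewrite /sd_mul /sd_inv /= -gaction_morph !mulVg theta1.
Qed.
Fact sd_Vmul : right_inverse sd_one sd_inv sd_mul.
Proof.
by move=> [m k]; rewrite /sd_mul /sd_inv /= -gactionM !mulgV gaction1 mulgV.
Qed.

HB.instance Definition _ := isGroup.Build sdprod_type
  sd_mulA sd_mul1 sd_1mul sd_mulV sd_Vmul.

End SemidirectProduct.

Definition action_mx : 'M[int]_3 :=
  \matrix_(i < 3, j < 3)
    nth 0%R (nth [::] [:: [:: 0; 0; 1];
                          [:: 1; 0; 0];
                          [:: 0; 1; 0]]%R i) j.

Section Z3Action.
Local Open Scope ring_scope.

Definition Z3_act (k : 'Z_3) (u : Zlattice 3) : Zlattice 3 :=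
  (action_mx ^+ k *m (u : 'cV[int]_3) : 'cV[int]_3).

Lemma action_mx3 : action_mx ^+ 3 = 1.
Proof.
rewrite !exprS expr0 mulr1 -!mulmxE; apply/matrixP => i j.
rewrite !(mxE, big_ord_recl, big_ord0).
by case: i => [[|[|[|//]]] Hi]; case: j => [[|[|[|//]]] Hj].
Qed.

Fact Z3_act1 u : Z3_act 1%g u = u.
Proof. by rewrite /Z3_act expr0 mul1mx. Qed.
Fact Z3_actM k l u : Z3_act (k * l)%g u = Z3_act k (Z3_act l u).
Proof.
rewrite /Z3_act mulmxA mulmxE -exprD; congr (_ *m _).
by rewrite -[RHS](expr_mod _ action_mx3).
Qed.
Fact Z3_act_morph k : {morph Z3_act k : u v / (u * v)%g}.
Proof. by move=> u v; rewrite /Z3_act mulmxDr. Qed.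

End Z3Action.

(* Z_3 is written additively as ['Z_3]; its class [k] acts on Z^3 by the [k]-th
   power of [action_mx]. *)
Definition Z3_action : group_action (Zlattice 3) 'Z_3 :=
  GroupAction Z3_act1 Z3_actM Z3_act_morph.

Definition Zbasis (i : 'I_3) : Zlattice 3 := (delta_mx i 0%R : 'cV[int]_3).

(* (1,2) and (1,3,2), with strings numbered from 0 *)
Definition perm12 : 'S_3 := tperm 0%R 1%R.
Definition perm132 : 'S_3 := tperm 0%R 2%R * tperm 0%R 1%R.

Lemma perm132E : [/\ perm132 0%R = 2%R, perm132 2%R = 1%R & perm132 1%R = 0%R].
Proof. by split; rewrite permM !permE /= ?permE. Qed.

(* Main.v *)
Require Import Defs.
From HB Require Import structures.
From mathcomp Require Import all_boot all_order all_algebra all_fingroup cyclic.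
From mathcomp Require Import all_classical all_reals all_analysis.
From mathcomp Require Import zify ring lra.

Set Implicit Arguments.
Unset Strict Implicit.
Unset Printing Implicit Defensive.

Import Order.TTheory GRing.Theory Num.Theory.
Import numFieldNormedType.Exports generic_quotient.
Import GroupScope.
Local Open Scope classical_set_scope.
Local Open Scope group_scope.

(** Write N for the commutator subgroup of P_3.  A braid records, for each pair
    of strings, its signed number of crossings; halving these numbers and
    letting the permutation act on pairs gives a representation [rho] of B_3 by
    isometries of R^3, sending A12, A23, A13 to the unit translations.  Modulo
    N, every braid is A12^a A23^b A13^c times one of six coset representatives,
    so [rho] is faithful on B_3 / N, and every sigma^-1(H) / N acts as a
    crystallographic group containing the translations by Z^3.

    For rigidity, let Gam be a cocompact group of isometries isomorphic to one
    of these groups.  Cocompactness makes the orbit of 0 coarsely dense.  An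
    element g of the free abelian subgroup (of index at most 2) commutes with a
    coarsely dense set of elements, so its displacement is bounded; hence the
    linear part of g is trivial.  The abelian subgroup is therefore a lattice
    of translations, and density forces it to have full rank.  An affine map
    matching lattice bases (and, in case (b), the glide reflections) conjugates
    Gam to the model group and descends to a diffeomorphism. *)

(** * Groups and isomorphisms *)

Section GroupMorphisms.
Variables G H : groupType.

Lemma gmorph1 (f : G -> H) : {morph f : x y / x * y} -> f 1 = 1.
Proof. by move=> fM; apply: (@mulgI _ (f 1)); rewrite -fM !mulg1. Qed.

Lemma gmorphV (f : G -> H) : {morph f : x y / x * y} -> {morph f : x / x^-1}.
Proof.
by move=> fM x; apply: (@mulgI _ (f x)); rewrite -fM !mulgV gmorph1.
Qed.

Lemma gmorphX (f : G -> H) n : {morph f : x y / x * y} -> {morph f : x / x ^+ n}.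
Proof.
move=> fM x; elim: n => [|n IH]; first by rewrite !expg0 gmorph1.
by rewrite !expgS fM IH.
Qed.

(** An isomorphism is a total function constrained only on [A], so the inverse is chosen pointwise
    on [B]. Closure of [A] under products lets [g] be evaluated at [f x * f y = f (x * y)]. *)
Lemma is_isomorphism_inv (A : {pred G}) (B : {pred H}) (f : G -> H) :
    {in A &, forall x y, x * y \in A} -> is_isomorphism A B f ->
  exists g : H -> G, [/\ is_isomorphism B A g, {in A, cancel f g} &
                         {in B, cancel g f}].
Proof.
move=> AM [fM [fA finj fsurj]].
have /choice [g gP] (y : H) : exists x, y \in B -> x \in A /\ f x = y.
  have [By|_] := boolP (y \in B); last by exists 1.
  by have [x Ax <-] := fsurj _ By; exists x.
have gK : {in B, cancel g f} by move=> y /gP[].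
have fK : {in A, cancel f g}.
  move=> x Ax; have Bfx : f x \in B by exact: fA.
  have [Agx fgx] := gP _ Bfx.
  by apply: finj => //; exact/mem_set.
exists g; split=> //; split.
  move=> _ _ /fsurj[x Ax <-] /fsurj[y Ay <-].
  by rewrite -fM // !fK // AM.
split.
- by move=> y /gP[].
- move=> y z /set_mem By /set_mem Bz /(congr1 f).
  by rewrite !gK.
- by move=> x Ax; exists (f x); [exact: fA|exact: fK].
Qed.

Lemma isomorphism_of_embedding (A : {pred G}) (g : H -> G) :
    {morph g : x y / x * y} -> injective g ->
    (forall x, x \in A <-> exists y, x = g y) ->
  exists f : G -> H, is_isomorphism A (predT : {pred H}) f /\ cancel g f.
Proof.
move=> gM ginj gA.
have gAP y : g y \in A by apply/gA; exists y.
have /choice [f fP] (x : G) : exists y, x \in A -> x = g y.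
  have [/gA[y ->]|_] := boolP (x \in A); first by exists y.
  by exists 1.
have gK : cancel g f by move=> y; apply: ginj; rewrite -fP.
exists f; split=> //; split.
  by move=> x y /gA[u ->] /gA[v ->]; rewrite -gM !gK.
split=> //.
- move=> x y /set_mem/gA[u ->] /set_mem/gA[v ->].
  by rewrite !gK => ->.
- by move=> y _; exists (g y); [exact: gAP|exact: gK].
Qed.

End GroupMorphisms.

Lemma isomorphic_torsion_free (G H : groupType) (A : groupClosed G)
    (B : {pred H}) : isomorphic A B -> torsion_free A -> torsion_free B.
Proof.
move=> [f fiso] tfA.
have [g [[gM [gB ginj gsurj]] fK gK]] := is_isomorphism_inv (@gpredM _ A) fiso.
have [fM [fA _ _]] := fiso.
have BM x y : x \in B -> y \in B -> x * y \in B.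
  move=> Bx By; rewrite -[x]gK // -[y]gK // -fM; [|exact: gB..].
  by apply: fA; apply: gpredM; exact: gB.
have f1 : f 1 = 1.
  by apply: (@mulgI _ (f 1)); rewrite -fM ?gpred1 // !mulg1.
have B1 : 1 \in B by rewrite -f1; apply: fA; exact: gpred1.
have g1 : g 1 = 1 by rewrite -f1 fK // gpred1.
have BX x n : x \in B -> x ^+ n \in B /\ g (x ^+ n) = g x ^+ n.
  move=> Bx; elim: n => [|n [BXn gXn]]; first by rewrite !expg0 g1.
  by rewrite !expgS; split; [exact: BM|rewrite gM // gXn].
move=> x n Bx n0 xn1; rewrite -[x]gK // (_ : g x = 1) //.
apply: (tfA _ n) => //; first exact: gB.
by have [_ <-] := BX x n Bx; rewrite xn1.
Qed.

Lemma isomorphic_holonomy (d : nat) (G H : groupType) (A : groupClosed G)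
    (B : {pred H}) (Phi : finGroupType) :
  isomorphic A B -> has_holonomy d A Phi -> has_holonomy d B Phi.
Proof.
move=> [f fiso] [i [p [[iinj iM] pM psurj pker pfaith]]].
have [g [[gM [gB ginj gsurj]] fK gK]] := is_isomorphism_inv (@gpredM _ A) fiso.
have [fM [fA _ _]] := fiso.
have gBP y : y \in B -> g y \in A by exact: gB.
have fAP x : x \in A -> f x \in B by exact: fA.
have Ai u : i u \in A by have [|] := (pker (i u)).2 _; first by exists u.
have BM x y : x \in B -> y \in B -> x * y \in B.
  by move=> Bx By; rewrite -[x]gK // -[y]gK // -fM ?gBP // fAP // gpredM ?gBP.
exists (f \o i), (p \o g); split.
- split; last by move=> u v /=; rewrite iM fM.
  by move=> u v /= /(congr1 g); rewrite !fK // => /iinj.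
- by move=> x y Bx By /=; rewrite gM // pM // gBP.
- by move=> c; have [x Ax <-] := psurj c; exists (f x); rewrite ?fAP //= fK.
- move=> x; split => [[Bx /= px]|[u ->]].
    have [u gxE] := (pker (g x)).1 (conj (gBP _ Bx) px).
    by exists u; rewrite /= -gxE gK.
  by split => /=; rewrite ?fAP ?fK //; case: ((pker (i u)).2 (ex_intro _ u erefl)).
- move=> x Bx xc /=; apply: pfaith; first exact: gBP.
  (* Multiplying by [x] removes [x^-1], since [B] is not known to be closed under inverses. *)
  move=> u; have /(congr1 (fun y => g (y * x))) := xc u.
  rewrite mulgVK !gM ?fAP ?BM ?fAP // fK // => ->.
  by rewrite mulgK.
Qed.

(** * Integer powers and homomorphisms from Z^d *)

Section IntegerPowers.
Variable G : groupType.
Implicit Types (x y : G) (n : int).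

Definition zpow x n : G :=
  match n with Posz k => x ^+ k | Negz k => x ^- k.+1 end.

Lemma zpow0 x : zpow x 0 = 1. Proof. exact: expg0. Qed.
Lemma zpowSr x n : zpow x (n + 1)%R = zpow x n * x.
Proof.
case: n => [k|[|k]].
- by rewrite addrC -intS /= expgSr.
- by rewrite /= expg1 mulVg.
- rewrite (_ : (Negz k.+1 + 1)%R = Negz k) /=; last first.
    by rewrite !NegzE (intS k.+1) opprD addrAC addNr add0r.
  by rewrite [in RHS]expgS invgM mulgVK.
Qed.

Lemma zpow_pr x n : zpow x (n - 1)%R = zpow x n * x^-1.
Proof. by rewrite -[in RHS](subrK 1%R n) zpowSr mulgK. Qed.

Lemma zpowD x m n : zpow x (m + n)%R = zpow x m * zpow x n.
Proof.
elim/int_rect: n => [|k IH|k IH].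
- by rewrite addr0 zpow0 mulg1.
- by rewrite -addn1 PoszD addrA !zpowSr IH mulgA.
- by rewrite -addn1 PoszD opprD addrA !zpow_pr IH mulgA.
Qed.

(** Phrased as a reordering rule, so that it applies directly to relations such as
    [S1 * A23 = A13 * S1]. *)
Lemma zpow_conj a x y n : a * x = y * a -> a * zpow x n = zpow y n * a.
Proof.
move=> ax; elim/int_rect: n => [|k IH|k IH].
- by rewrite !zpow0 mulg1 mul1g.
- by rewrite -addn1 PoszD !zpowSr mulgA IH -!mulgA ax.
- rewrite -addn1 PoszD opprD !zpow_pr mulgA IH -!mulgA; congr (_ * _).
  by apply: (@mulgI _ y); rewrite mulVKg mulgA -ax mulgK.
Qed.

Lemma zpow_commute x y m n :
  commute x y -> commute (zpow x m) (zpow y n).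
Proof. by move=> xy; do 2![apply: zpow_conj; apply: commute_sym]. Qed.

End IntegerPowers.

Section LatticeMorphism.
Variables (d : nat) (G : groupType) (a : 'I_d -> G).

Definition lattice_hom (v : Zlattice d) : G :=
  \prod_(i < d) zpow (a i) ((v : 'cV[int]_d) i 0%R).

Lemma lattice_homM : (forall i j, commute (a i) (a j)) ->
  {morph lattice_hom : u v / u * v}.
Proof.
move=> ac u v; rewrite /lattice_hom -prodgM_commute //=.
  by apply: eq_bigr => i _; rewrite mxE zpowD.
by move=> i j _ _; exact: zpow_commute.
Qed.

End LatticeMorphism.

(** * Braids modulo the commutator subgroup of the pure braids *)

Lemma presented_ind (X : choiceType) (rels : word X -> word X -> Prop)
    (P : presented rels -> Prop) :
    P 1 -> (forall x g, P g -> P (pres_gen rels x * g)) ->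
    (forall x g, P g -> P ((pres_gen rels x)^-1 * g)) ->
  forall g, P g.
Proof.
move=> P1 PM PV g; rewrite -(of_word_repr g); elim: (repr g) => [|[x b] w IH].
  exact: P1.
rewrite -cat1s of_word_cat; case: b; first exact: PM.
have -> : of_word rels [:: (x, false)] = (pres_gen rels x)^-1.
  apply: (@mulIg _ (pres_gen rels x)); rewrite mulVg /pres_gen -of_word_cat.
  by apply/of_wordP; exact: (wc_cancel _ x false).
exact: PV.
Qed.

Lemma ord2P (i : 'I_2) : i = ord0 \/ i = ord_max.
Proof. by case: i => [[|[|//]] i2]; [left|right]; exact: val_inj. Qed.

Lemma B3_ind (P : B3 -> Prop) :
    P 1 -> (forall g, P g -> [/\ P (s1 * g), P (s2 * g), P (s1^-1 * g) &
                                 P (s2^-1 * g)]) ->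
  forall g, P g.
Proof.
move=> P1 PM; apply: presented_ind => // i g /PM[? ? ? ?];
  by case: (ord2P i) => ->.
Qed.

Section AbelianizedBraids.
Local Notation P3' := (commutator_subgroup P3 : normalClosed B3).

Lemma quotient_projM : {morph qclass P3' : x y / x * y}.
Proof. exact: qclassM. Qed.

Definition S1 : B3Q := qclass P3' s1.
Definition S2 : B3Q := qclass P3' s2.

Lemma qclass_commute (x y : B3) : x \in P3 -> y \in P3 ->
  commute (qclass P3' x) (qclass P3' y).
Proof.
move=> Px Py; rewrite /commute -!quotient_projM; apply/qclassP.
apply/gen_subgroupP => K; apply; apply/mem_set.
by exists y, x; split; rewrite // /commg /conjg invgM !mulgA.
Qed.

Lemma sigma_s1 : sigma s1 = tperm 0%R 1%R.
Proof.
rewrite /sigma /s1 pres_lift_gen; last exact: transp_rel.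
by congr (tperm _ _); exact: val_inj.
Qed.

Lemma sigma_s2 : sigma s2 = tperm 1%R 2%R.
Proof.
rewrite /sigma /s2 pres_lift_gen; last exact: transp_rel.
by congr (tperm _ _); exact: val_inj.
Qed.

Lemma s1sq_pure : s1 ^+ 2 \in P3.
Proof. by rewrite P3E expg2 sigmaM sigma_s1 tperm2. Qed.

Lemma s2sq_pure : s2 ^+ 2 \in P3.
Proof. by rewrite P3E expg2 sigmaM sigma_s2 tperm2. Qed.

Lemma s2s1sq_pure : s2 * s1 ^+ 2 * s2^-1 \in P3.
Proof. by have := P3J s2^-1 s1sq_pure; rewrite /conjg invgK mulgA. Qed.

Lemma A12E : A12 = S1 * S1. Proof. exact: quotient_projM. Qed.
Lemma A23E : A23 = S2 * S2. Proof. exact: quotient_projM. Qed.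
Lemma A13E : A13 = S2 * A12 * S2^-1.
Proof. by rewrite /A13 2!quotient_projM (gmorphV quotient_projM). Qed.

Lemma S_braid : S1 * S2 * S1 = S2 * S1 * S2.
Proof.
by have /(congr1 (qclass P3')) := braid_relation; rewrite !quotient_projM.
Qed.

Lemma S1_A12 : S1 * A12 = A12 * S1.
Proof. by rewrite A12E mulgA. Qed.

Lemma S2_A23 : S2 * A23 = A23 * S2.
Proof. by rewrite A23E mulgA. Qed.

Lemma S2_A12 : S2 * A12 = A13 * S2.
Proof. by rewrite A13E mulgVK. Qed.

Lemma A12_A23 : commute A12 A23.
Proof. exact: qclass_commute s1sq_pure s2sq_pure. Qed.

Lemma A12_A13 : commute A12 A13.
Proof. exact: qclass_commute s1sq_pure s2s1sq_pure. Qed.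

Lemma A23_A13 : commute A23 A13.
Proof. exact: qclass_commute s2sq_pure s2s1sq_pure. Qed.

(** The square [A23] of [S2] commutes with [A12], so conjugating [A12] twice by [S2] gives [A12]
    back. *)
Lemma S2_A13 : S2 * A13 = A12 * S2.
Proof.
by rewrite A13E !mulgA -A23E -A12_A23 A23E !mulgA mulgK.
Qed.

Lemma S1_A23 : S1 * A23 = A13 * S1.
Proof.
(* By the braid relation, conjugation by [S2 * S1] turns [S2] into [S1], hence [A23] into [A12]. *)
have H : S2 * S1 * A23 = A12 * S2 * S1.
  by rewrite A23E A12E mulgA -S_braid -!mulgA; congr (_ * _); rewrite !mulgA S_braid.
apply: (@mulgI _ S2); rewrite mulgA H mulgA S2_A13.
by [].
Qed.

Lemma S1_A13 : S1 * A13 = A23 * S1.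
Proof.
apply: (@mulgI _ S1).
by rewrite mulgA -A12E A12_A13 mulgA S1_A23 -mulgA -A12E.
Qed.

Definition A3 (i : 'I_3) : B3Q := nth A12 [:: A12; A23; A13] i.

Lemma A3_commute i j : commute (A3 i) (A3 j).
Proof.
by case: i => [[|[|[|//]]] ?]; case: j => [[|[|[|//]]] ?]; rewrite /A3 /=;
  try exact: commute_refl; try apply: commute_sym; try exact: A12_A23;
  try exact: A12_A13; try exact: A23_A13; apply: commute_sym; try exact: A12_A23;
  try exact: A12_A13; try exact: A23_A13.
Qed.

Definition A3_hom : Zlattice 3 -> B3Q := lattice_hom A3.

Lemma A3_homM : {morph A3_hom : u v / u * v}.
Proof. exact: lattice_homM A3_commute. Qed.

Lemma A3_homE v : A3_hom v =
  zpow A12 ((v : 'cV[int]_3) 0%R 0%R) * zpow A23 ((v : 'cV[int]_3) 1%R 0%R) *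
  zpow A13 ((v : 'cV[int]_3) 2%R 0%R).
Proof.
rewrite /A3_hom /lattice_hom !big_ord_recl big_ord0 mulg1 mulgA /A3 /=.
by congr (_ * zpow _ (v _ _) * zpow _ (v _ _)); exact: val_inj.
Qed.

Lemma A3_hom_basis i : A3_hom (Zbasis i) = A3 i.
Proof.
rewrite A3_homE /Zbasis !mxE.
by case: i => [[|[|[|//]]] ?]; rewrite /A3 /= ?expg0 ?expg1 ?mul1g ?mulg1.
Qed.

Definition perm_lattice (s : 'S_3) (v : Zlattice 3) : Zlattice 3 :=
  (row_perm s (v : 'cV[int]_3)).

(** The transposition (1,2) fixes the pair {1,2} and exchanges {2,3} with {1,3}; these pairs are the
    coordinates 0, 1 and 2. *)
Lemma S1_A3_hom v : S1 * A3_hom v = A3_hom (perm_lattice (tperm 1 2)%R v) * S1.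
Proof.
rewrite !A3_homE /perm_lattice !mxE tpermL tpermR tpermD //.
rewrite !mulgA (zpow_conj _ S1_A12) -!mulgA; congr (_ * _).
rewrite mulgA (zpow_conj _ S1_A23) -mulgA (zpow_conj _ S1_A13) !mulgA.
by rewrite (zpow_commute _ _ A23_A13).
Qed.

Lemma S2_A3_hom v : S2 * A3_hom v = A3_hom (perm_lattice (tperm 0 2)%R v) * S2.
Proof.
rewrite !A3_homE /perm_lattice !mxE tpermL tpermR tpermD //.
rewrite !mulgA (zpow_conj _ S2_A12) -!mulgA.
rewrite (mulgA S2) (zpow_conj _ S2_A23) -mulgA (zpow_conj _ S2_A13) !mulgA.
congr (_ * _).
rewrite -mulgA -(zpow_commute _ _ A12_A23) mulgA.
rewrite -(zpow_commute _ _ A12_A13) -!mulgA; congr (_ * _).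
exact/commute_sym/zpow_commute/A23_A13.
Qed.

(** * Normal forms modulo the commutator subgroup *)

Definition coset_reps : seq B3Q :=
  [:: 1; S1; S2; S1 * S2; S2 * S1; S1 * S2 * S1].

(** The representatives are reduced words lifting the six permutations. Only existence of such a
    form is meant, not uniqueness. *)
Definition normal_form (q : B3Q) : Prop :=
  exists v t, t \in coset_reps /\ q = A3_hom v * t.

Lemma normal_formA v q : normal_form q -> normal_form (A3_hom v * q).
Proof.
by move=> [w [t [tr ->]]]; exists (v * w), t; rewrite A3_homM mulgA.
Qed.

Lemma normal_form_rep t : t \in coset_reps -> normal_form t.
Proof.
move=> tr; exists 1, t; split=> //.
by rewrite (gmorph1 A3_homM) mul1g.
Qed.

Lemma normal_form_A3_rep i t : t \in coset_reps -> normal_form (A3 i * t).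
Proof.
by move=> tr; rewrite -A3_hom_basis; exact/normal_formA/normal_form_rep.
Qed.

Lemma coset_repsP (P : B3Q -> Prop) : P 1 -> P S1 -> P S2 -> P (S1 * S2) ->
  P (S2 * S1) -> P (S1 * S2 * S1) -> forall t, t \in coset_reps -> P t.
Proof.
move=> p1 p2 p3 p4 p5 p6 t; rewrite !inE.
by do 5![case/predU1P=> [->//|]]; move/eqP=> ->.
Qed.

(** Left multiplication by [S1] either gives another word of the list or creates the square [A12],
    which the lattice absorbs. *)
Lemma normal_formS1 q : normal_form q -> normal_form (S1 * q).
Proof.
move=> [v [t [tr ->]]]; rewrite mulgA S1_A3_hom -mulgA; apply: normal_formA.
have m t' : t' \in coset_reps -> normal_form t' by exact: normal_form_rep.
have mA t' : t' \in coset_reps -> normal_form (A12 * t').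
  exact: (normal_form_A3_rep 0%R).
move: t tr; apply: coset_repsP; rewrite ?mulg1 ?mulgA -?A12E.
- by apply: m; rewrite !inE eqxx !orbT.
- by rewrite -[A12]mulg1; apply: mA; rewrite !inE eqxx.
- by apply: m; rewrite !inE eqxx !orbT.
- by apply: mA; rewrite !inE eqxx !orbT.
- by apply: m; rewrite !inE eqxx !orbT.
- by rewrite -mulgA; apply: mA; rewrite !inE eqxx !orbT.
Qed.

Lemma normal_formS2 q : normal_form q -> normal_form (S2 * q).
Proof.
move=> [v [t [tr ->]]]; rewrite mulgA S2_A3_hom -mulgA; apply: normal_formA.
have m t' : t' \in coset_reps -> normal_form t' by exact: normal_form_rep.
have mA t' : t' \in coset_reps -> normal_form (A23 * t').
  exact: (normal_form_A3_rep 1%R).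
move: t tr; apply: coset_repsP; rewrite ?mulg1 ?mulgA -?A23E.
- by apply: m; rewrite !inE eqxx !orbT.
- by apply: m; rewrite !inE eqxx !orbT.
- by rewrite -[A23]mulg1; apply: mA; rewrite !inE eqxx.
- by rewrite -S_braid; apply: m; rewrite !inE eqxx !orbT.
- by apply: mA; rewrite !inE eqxx !orbT.
(* On the longest word, the braid relation brings two letters [S2] together. *)
- have -> : S2 * S1 * S2 * S1 = A23 * (S1 * S2).
    by rewrite A23E -!mulgA; congr (_ * _); rewrite !mulgA S_braid.
  by apply: mA; rewrite !inE eqxx !orbT.
Qed.

Lemma mulA3_inv_normal_form i q : normal_form q -> normal_form ((A3 i)^-1 * q).
Proof.
by rewrite -A3_hom_basis -(gmorphV A3_homM); exact: normal_formA.
Qed.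

Lemma normal_form_ex q : normal_form q.
Proof.
rewrite -(qclass_repr q); move: (repr q); apply: B3_ind => [|g IH].
  by apply: normal_form_rep; rewrite !inE eqxx.
rewrite !quotient_projM !(gmorphV quotient_projM) -/S1 -/S2.
(* An inverse generator is a lattice element times the generator itself, so the positive cases
   suffice. *)
have S1V : S1^-1 = A12^-1 * S1 by rewrite A12E invgM mulgVK.
have S2V : S2^-1 = A23^-1 * S2 by rewrite A23E invgM mulgVK.
split; [exact: normal_formS1|exact: normal_formS2|rewrite S1V|rewrite S2V];
  rewrite -mulgA.
- exact/(mulA3_inv_normal_form 0%R)/normal_formS1.
- exact/(mulA3_inv_normal_form 1%R)/normal_formS2.
Qed.

(** * The induced homomorphism to S_3 *)

Definition sigmaQ (q : B3Q) : 'S_3 := sigma (repr q).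

(** This makes [sigma] constant on cosets, so that [sigmaQ] does not depend on the chosen
    representative. *)
Lemma sigma_commutator x : x \in commutator_subgroup P3 -> x \in P3.
Proof.
move/gen_subgroupP; apply=> _ /set_mem[u [v [Pu Pv ->]]].
exact: gpredR.
Qed.

Lemma sigmaQE x : sigmaQ (qclass P3' x) = sigma x.
Proof.
have [n /sigma_commutator nP E] := repr_qclass P3' x.
by rewrite /sigmaQ E sigmaM; move: nP; rewrite P3E => /eqP ->; rewrite mulg1.
Qed.

Lemma sigmaQM : {morph sigmaQ : p q / p * q}.
Proof.
move=> p q; rewrite -(qclass_repr p) -(qclass_repr q) -quotient_projM.
by rewrite !sigmaQE sigmaM.
Qed.

Lemma quotient_subgroupE (A : {pred 'S_3}) q :
  (q \in quotient_subgroup (fun x : B3 => sigma x \in A) P3') =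
  (sigmaQ q \in A).
Proof.
apply/asboolP/idP => [[x Ax ->]|Aq]; first by rewrite sigmaQE.
by exists (repr q); rewrite ?qclass_repr.
Qed.

Lemma HtildeE (H : {group 'S_3}) q : (q \in Htilde H) = (sigmaQ q \in H).
Proof. exact: quotient_subgroupE. Qed.

Lemma P3QE q : (q \in P3Q) = (sigmaQ q == 1).
Proof.
rewrite -[RHS]/(sigmaQ q \in pred1 1) -quotient_subgroupE.
by [].
Qed.

Lemma sigmaQ_S1 : sigmaQ S1 = tperm 0%R 1%R.
Proof. by rewrite sigmaQE sigma_s1. Qed.

Lemma sigmaQ_S2 : sigmaQ S2 = tperm 1%R 2%R.
Proof. by rewrite sigmaQE sigma_s2. Qed.

Lemma sigmaQ_A3 i : sigmaQ (A3 i) = 1.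
Proof.
case: i => [[|[|[|//]]] ?]; rewrite /A3 /= sigmaQE; apply/eqP.
- exact: s1sq_pure.
- exact: s2sq_pure.
- exact: s2s1sq_pure.
Qed.

Lemma sigmaQ_A3_hom v : sigmaQ (A3_hom v) = 1.
Proof.
have zpow1g (G : groupType) n : zpow (1 : G) n = 1.
  by case: n => k /=; rewrite expg1n ?invg1.
have sV := gmorphV sigmaQM.
have sX (x : B3Q) n : sigmaQ (zpow x n) = zpow (sigmaQ x) n.
  by case: n => k /=; rewrite ?sV (gmorphX _ sigmaQM).
by rewrite A3_homE !sigmaQM !sX (sigmaQ_A3 0%R) (sigmaQ_A3 1%R) (sigmaQ_A3 2%R)
  !zpow1g !mulg1.
Qed.

End AbelianizedBraids.

(** * A faithful isometric representation *)

Section MorphismKernel.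
Variables (G H : groupType) (f : G -> H) (fM : {morph f : x y / x * y}).

(** The morphism proof is an argument so that the subgroup instances can recover it from the
    term. *)
Definition morph_ker of {morph f : x y / x * y} : {pred G} :=
  fun x => f x == 1.

Lemma morph_kerE x : (x \in morph_ker fM) = (f x == 1). Proof. by []. Qed.
Fact morph_kerM : mulg_closed (morph_ker fM).
Proof.
by move=> x y; rewrite !morph_kerE fM => /eqP -> /eqP ->; rewrite mulg1.
Qed.
Fact morph_ker1 : 1 \in morph_ker fM.
Proof. by rewrite morph_kerE gmorph1. Qed.
Fact morph_kerV : invg_closed (morph_ker fM).
Proof.
by move=> x; rewrite !morph_kerE (gmorphV fM) => /eqP ->; rewrite invg1.
Qed.

HB.instance Definition _ := isMulClosed.Build G (morph_ker fM) morph_kerM.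
HB.instance Definition _ := isMul1Closed.Build G (morph_ker fM) morph_ker1.
HB.instance Definition _ := isInvClosed.Build G (morph_ker fM) morph_kerV.

End MorphismKernel.

(** * Translations and isometries permuting the coordinates *)

Section PermIsometries.
Variables (R : realType) (d : nat).
Local Open Scope ring_scope.

Lemma lin1 : lin (1%g : eisom R d) = 1%:M. Proof. by []. Qed.
Lemma tr1 : tr (1%g : eisom R d) = 0. Proof. by []. Qed.
Lemma linM (g h : eisom R d) : lin (g * h)%g = lin g *m lin h.
Proof. by []. Qed.
Lemma trM (g h : eisom R d) : tr (g * h)%g = tr g + lin g *m tr h.
Proof. by []. Qed.
Lemma linV (g : eisom R d) : lin g^-1%g = (lin g)^T. Proof. by []. Qed.
Lemma tr_transl (v : 'cV[R]_d) : tr (transl v) = v. Proof. by []. Qed.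
Lemma lin_transl (v : 'cV[R]_d) : lin (transl v) = 1%:M. Proof. by []. Qed.

Lemma translM (v w : 'cV[R]_d) : transl (v + w) = (transl v * transl w)%g.
Proof.
apply: eisomP; first by rewrite trM lin_transl mul1mx.
by rewrite linM !lin_transl mulmx1.
Qed.

Lemma transl0 : transl (0 : 'cV[R]_d) = 1%g.
Proof. exact: eisomP. Qed.

Lemma translN (v : 'cV[R]_d) : transl (- v) = (transl v)^-1%g.
Proof. by apply: (@mulgI _ (transl v)); rewrite -translM mulgV subrr transl0. Qed.

Lemma zpow_transl (v : 'cV[R]_d) n : zpow (transl v) n = transl (n%:~R *: v).
Proof.
elim/int_rect: n => [|k IH|k IH].
- by rewrite zpow0 scale0r transl0.
- by rewrite -addn1 PoszD zpowSr IH -translM intrD scalerDl scale1r.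
- rewrite -addn1 PoszD opprD zpow_pr IH -translN -translM intrD scalerDl.
  by rewrite intrN scaleN1r.
Qed.

Lemma lin1_transl (g : eisom R d) : lin g = 1%:M -> g = transl (tr g).
Proof. by move=> g1; exact: eisomP. Qed.

Fact pisom_subproof (s : 'S_d) (v : 'cV[R]_d) :
  let p := (v, perm_mx s : 'M[R]_d) in p.2^T *m p.2 == 1%:M.
Proof. by rewrite /= tr_perm_mx -perm_mxM mulVg perm_mx1. Qed.

Definition pisom s v := Isom (pisom_subproof s v).

Lemma lin_pisom s v : lin (pisom s v) = perm_mx s. Proof. by []. Qed.
Lemma tr_pisom s v : tr (pisom s v) = v. Proof. by []. Qed.

Lemma pisomM s t v w : (pisom s v * pisom t w)%g = pisom (s * t) (v + row_perm s w).
Proof.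
by apply: eisomP; rewrite ?trM ?linM ?lin_pisom ?tr_pisom ?row_permE ?perm_mxM.
Qed.

Lemma pisom1 v : pisom 1 v = transl v.
Proof. by apply: eisomP; rewrite // lin_pisom perm_mx1. Qed.

End PermIsometries.

Lemma perm_mx_inj (R : realType) n : injective (fun s : 'S_n => perm_mx s : 'M[R]_n).
Proof.
move=> s t /matrixP st; apply/permP => i.
have := st i (s i); rewrite !mxE eqxx.
by case: eqP => [->//|_] /eqP; rewrite oner_eq0.
Qed.

Section CrystalRepresentation.
Variable R : realType.
Local Open Scope ring_scope.
Local Notation P3' := (commutator_subgroup P3 : normalClosed B3).

(** A crossing adds one half to the coordinate of the two strings involved and exchanges the other
    two pairs; its square is then a unit translation. *)
Definition rho_gen (i : 'I_2) : eisom R 3 :=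
  if i == ord0 then pisom (tperm 1 2) (2^-1 *: delta_mx 0 0)
  else pisom (tperm 0 2) (2^-1 *: delta_mx 1 0).

Lemma rho_gen_rel u v : braid_rel u v -> eval_word rho_gen u = eval_word rho_gen v.
Proof.
case; rewrite /eval_word !big_cons !big_nil /= !mulg1 /rho_gen /=.
rewrite !pisomM; congr (pisom _ _).
  apply/permP => i; rewrite !permM.
  by case: i => [[|[|[|//]]] Hi]; rewrite !permE /=; apply/eqP.
apply/matrixP => i j; rewrite !mxE !permE.
by case: i => [[|[|[|//]]] Hi];
  rewrite ord1 /= ?permE /= ?permE /= ?mulr1 ?mulr0 ?addr0 ?add0r.
Qed.

Definition rho : B3 -> eisom R 3 := pres_lift rho_gen.

Lemma rhoM : {morph rho : x y / (x * y)%g}.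
Proof. exact: pres_liftM rho_gen_rel. Qed.

Lemma rho_s1 : rho s1 = pisom (tperm 1 2) (2^-1 *: delta_mx 0 0).
Proof. by rewrite /rho /s1 pres_lift_gen //; exact: rho_gen_rel. Qed.

Lemma rho_s2 : rho s2 = pisom (tperm 0 2) (2^-1 *: delta_mx 1 0).
Proof. by rewrite /rho /s2 pres_lift_gen //; exact: rho_gen_rel. Qed.

(* Conjugation by the cyclic permutation [k |-> k + 1] turns the action on
   strings into the action on the pairs {1,2}, {2,3}, {1,3}, in this order. *)
Lemma lin_rho g : lin (rho g) = perm_mx (sigma g ^ perm132^-1)%g.
Proof.
have [p0 p2 p1] := perm132E.
have q : [/\ perm132^-1%g 0 = 1, perm132^-1%g 1 = 2 & perm132^-1%g 2 = 0].
  by split; apply: (@perm_inj _ perm132); rewrite permKV ?p0 ?p1 ?p2.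
have [q0 q1 q2] := q.
have l1 : lin (rho s1) = perm_mx (sigma s1 ^ perm132^-1)%g.
  by rewrite rho_s1 sigma_s1 tpermJ q0 q1.
have l2 : lin (rho s2) = perm_mx (sigma s2 ^ perm132^-1)%g.
  by rewrite rho_s2 sigma_s2 tpermJ q1 q2 tpermC.
elim/B3_ind: g => [|g IH].
  by rewrite (gmorph1 rhoM) sigma1 conj1g perm_mx1.
split; rewrite rhoM sigmaM conjMg perm_mxM linM IH ?l1 ?l2 //.
  by rewrite (gmorphV rhoM) linV l1 sigmaV conjVg tr_perm_mx.
by rewrite (gmorphV rhoM) linV l2 sigmaV conjVg tr_perm_mx.
Qed.

Lemma rho_pure g : g \in P3 -> rho g = transl (tr (rho g)).
Proof.
rewrite P3E => /eqP sg; apply: lin1_transl.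
by rewrite lin_rho sg conj1g perm_mx1.
Qed.

Lemma rho_commutator g : g \in commutator_subgroup P3 -> rho g = 1%g.
Proof.
(* Pure braids act by translations, which commute, so the kernel of [rho] contains all the
   generating commutators. *)
move=> /gen_subgroupP/(_ (morph_ker rhoM)) H; apply/eqP; apply: H.
move=> _ /set_mem[x [y [/rho_pure xE /rho_pure yE ->]]].
rewrite morph_kerE /commg /conjg !rhoM !(gmorphV rhoM) xE yE.
rewrite -!translN -!translM; apply/eqP.
by rewrite (_ : _ + _ = 0) ?transl0 // addrCA addKr addNr.
Qed.

Definition rhoQ (q : B3Q) : eisom R 3 := rho (repr q).

Lemma rhoQE g : rhoQ (qclass P3' g) = rho g.
Proof.
have [n /rho_commutator nE E] := repr_qclass P3' g.
by rewrite /rhoQ E rhoM nE mulg1.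
Qed.

Lemma rhoQM : {morph rhoQ : p q / (p * q)%g}.
Proof.
move=> p q; rewrite -(qclass_repr p) -(qclass_repr q) -quotient_projM.
by rewrite !rhoQE rhoM.
Qed.

Lemma lin_rhoQ q : lin (rhoQ q) = perm_mx (sigmaQ q ^ perm132^-1)%g.
Proof. exact: lin_rho. Qed.

Lemma rhoQ_S1 : rhoQ S1 = pisom (tperm 1 2) (2^-1 *: delta_mx 0 0).
Proof. by rewrite rhoQE rho_s1. Qed.

Lemma rhoQ_S2 : rhoQ S2 = pisom (tperm 0 2) (2^-1 *: delta_mx 1 0).
Proof. by rewrite rhoQE rho_s2. Qed.

Lemma rhoQ_A3 i : rhoQ (A3 i) = transl (delta_mx i 0).
Proof.
have half (x : 'cV[R]_3) : 2^-1 *: x + 2^-1 *: x = x.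
  by rewrite -scalerDl (_ : 2^-1 + 2^-1 = 1 :> R) ?scale1r //; lra.
have q12 : rhoQ A12 = transl (delta_mx 0 0).
  rewrite A12E rhoQM rhoQ_S1 pisomM tperm2 pisom1; congr transl.
  rewrite -[RHS]half; congr (_ + _); apply/matrixP => j k.
  rewrite !mxE ord1; congr (_ * (_ && _)%:R).
  by rewrite (canF_eq (tpermK _ _)) tpermD.
have q23 : rhoQ A23 = transl (delta_mx 1 0).
  rewrite A23E rhoQM rhoQ_S2 pisomM tperm2 pisom1; congr transl.
  rewrite -[RHS]half; congr (_ + _); apply/matrixP => j k.
  rewrite !mxE ord1; congr (_ * (_ && _)%:R).
  by rewrite (canF_eq (tpermK _ _)) tpermD.
(* The image of [S2] exchanges coordinates 0 and 2, so conjugation by it takes the translation of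
   [A12] to that of [A13]. *)
have q13 : rhoQ A13 = transl (delta_mx 2 0).
  rewrite A13E !rhoQM (gmorphV rhoQM) q12 rhoQ_S2 -pisom1.
  apply: (@mulIg _ (pisom (tperm 0 2) (2^-1 *: delta_mx 1 0))).
  rewrite mulgVK -pisom1 !pisomM mul1g mulg1; congr pisom.
  apply/matrixP => j k; rewrite !mxE ord1 perm1 addrC; congr (_ + _).
  by rewrite (canF_eq (tpermK _ _)) tpermL.
by case: i => [[|[|[|//]]] ?]; rewrite /A3 /= ?q12 ?q23 ?q13;
   congr (transl (delta_mx _ _)); exact: val_inj.
Qed.

Lemma rhoQ_A3_hom (v : 'cV[int]_3) :
  rhoQ (A3_hom v) = transl (map_mx intr v).
Proof.
have rX (x : B3Q) n : rhoQ (zpow x n) = zpow (rhoQ x) n.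
  by case: n => k /=; rewrite ?(gmorphV rhoQM) (gmorphX _ rhoQM).
rewrite A3_homE !rhoQM !rX (rhoQ_A3 0) (rhoQ_A3 1) (rhoQ_A3 2).
rewrite !zpow_transl -!translM; congr transl.
apply/matrixP => i j; rewrite !mxE ord1.
by case: i => [[|[|[|//]]] ?] /=; rewrite ?mulr0 ?mulr1 ?addr0 ?add0r;
  congr (v _ _)%:~R; exact: val_inj.
Qed.

(* The statement does not mention [R], but injectivity is read off [rhoQ]. *)
Lemma A3_hom_inj : injective A3_hom.
Proof.
move=> u v /(congr1 (fun q => tr (rhoQ q))).
rewrite !rhoQ_A3_hom !tr_transl => /matrixP uv; apply/matrixP => i j.
by have := uv i j; rewrite !mxE => /intr_inj.
Qed.

Lemma A3_hom_ex q : sigmaQ q = 1%g -> exists v, q = A3_hom v.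
Proof.
have [v [t [tr ->]]] := normal_form_ex q.
rewrite sigmaQM sigmaQ_A3_hom mul1g => st; exists v.
suff -> : t = 1%g by rewrite mulg1.
(* The images of the first two strings tell each nontrivial representative from the identity. *)
move: t tr st; apply: coset_repsP => //;
  move=> /(congr1 (fun s : 'S_3 => (s 0, s 1)));
  by rewrite ?sigmaQM ?sigmaQ_S1 ?sigmaQ_S2 ?permM !permE /= ?permE => /eqP.
Qed.

Lemma sigmaQ_eq q r : sigmaQ q = sigmaQ r -> exists v, q = (A3_hom v * r)%g.
Proof.
move=> qr; have [|v E] := @A3_hom_ex (q * r^-1)%g.
  by rewrite sigmaQM (gmorphV sigmaQM) qr mulgV.
by exists v; rewrite -E mulgVK.
Qed.

(** The linear part determines the permutation, so the kernel lies in the lattice, where [rhoQ] is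
    the embedding of integer vectors as translations. *)
Lemma rhoQ_inj : injective rhoQ.
Proof.
suff K q : rhoQ q = 1%g -> q = 1%g.
  move=> p q pq; apply: (@mulIg _ q^-1%g); rewrite mulgV; apply: K.
  by rewrite rhoQM (gmorphV rhoQM) pq mulgV.
move=> q1; have /A3_hom_ex[v qE] : sigmaQ q = 1%g.
  have := lin_rhoQ q; rewrite q1 lin1 -perm_mx1 => /perm_mx_inj/esym/eqP.
  by rewrite conjg_eq1 => /eqP.
rewrite qE in q1 *; move: q1; rewrite rhoQ_A3_hom => /(congr1 (@tr _ _)).
rewrite tr_transl tr1 => /matrixP v0.
rewrite (_ : v = 1%g) ?(gmorph1 A3_homM) //; apply/matrixP => i j.
by have := v0 i j; rewrite !mxE => /eqP; rewrite intr_eq0 => /eqP.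
Qed.

End CrystalRepresentation.

(** * The subgroups over a subgroup of the symmetric group *)

Section HtildeGroups.
Variable H : {group 'S_3}.

Fact HtildeM : mulg_closed (Htilde H).
Proof. by move=> p q; rewrite !HtildeE sigmaQM; exact: groupM. Qed.
Fact Htilde1 : 1 \in Htilde H.
Proof. by rewrite HtildeE (gmorph1 sigmaQM) group1. Qed.
Fact HtildeV : invg_closed (Htilde H).
Proof. by move=> q; rewrite !HtildeE (gmorphV sigmaQM) groupV. Qed.

HB.instance Definition _ := isMulClosed.Build B3Q (Htilde H) HtildeM.
HB.instance Definition _ := isMul1Closed.Build B3Q (Htilde H) Htilde1.
HB.instance Definition _ := isInvClosed.Build B3Q (Htilde H) HtildeV.

Variable R : realType.

Definition crystal : {pred eisom R 3} :=
  fun g => `[< exists2 q, q \in Htilde H & g = rhoQ R q >].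

Lemma crystalP g :
  reflect (exists2 q, q \in Htilde H & g = rhoQ R q) (g \in crystal).
Proof. exact: asboolP. Qed.

Fact crystalM : mulg_closed crystal.
Proof.
move=> g h /crystalP[p Hp ->] /crystalP[q Hq ->]; apply/crystalP.
by exists (p * q); rewrite ?rhoQM ?gpredM.
Qed.
Fact crystal1 : 1 \in crystal.
Proof. by apply/crystalP; exists 1; rewrite ?gpred1 ?(gmorph1 (@rhoQM R)). Qed.
Fact crystalV : invg_closed crystal.
Proof.
move=> g /crystalP[q Hq ->]; apply/crystalP.
by exists q^-1; rewrite ?gpredV // (gmorphV (@rhoQM R)).
Qed.

HB.instance Definition _ := isMulClosed.Build (eisom R 3) crystal crystalM.
HB.instance Definition _ := isMul1Closed.Build (eisom R 3) crystal crystal1.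
HB.instance Definition _ := isInvClosed.Build (eisom R 3) crystal crystalV.

Lemma rhoQ_crystal q : q \in Htilde H -> rhoQ R q \in crystal.
Proof. by move=> Hq; apply/crystalP; exists q. Qed.

Lemma Htilde_crystal : isomorphic (Htilde H) crystal.
Proof.
exists (@rhoQ R); split; first by move=> p q _ _; exact: rhoQM.
split.
- by move=> q; exact: rhoQ_crystal.
- by move=> p q _ _; exact: rhoQ_inj.
- by move=> g /crystalP[q Hq ->]; exists q.
Qed.

Lemma A3_hom_Htilde v : A3_hom v \in Htilde H.
Proof. by rewrite HtildeE sigmaQ_A3_hom group1. Qed.

Lemma transl_crystal (v : 'cV[int]_3) : transl (map_mx intr v) \in crystal.
Proof. by rewrite -rhoQ_A3_hom rhoQ_crystal // A3_hom_Htilde. Qed.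

End HtildeGroups.

Arguments crystal : clear implicits.

(** * Lattice, torsion and holonomy *)

Lemma P3Q_Zlattice (R : realType) : isomorphic P3Q (predT : {pred Zlattice 3}).
Proof.
have [|f [fiso _]] := isomorphism_of_embedding A3_homM (@A3_hom_inj R) (A := P3Q).
  move=> q; rewrite P3QE; split=> [/eqP/A3_hom_ex//|[v ->]].
  by rewrite sigmaQ_A3_hom.
by exists f.
Qed.

Lemma lattice_expgE d (v : Zlattice d) n i j :
  (v ^+ n : 'cV[int]_d) i j = ((v : 'cV[int]_d) i j *+ n)%R.
Proof.
elim: n => [|n IH]; first by rewrite expg0 mulr0n mxE.
by rewrite expgS mulrS mxE IH.
Qed.

Lemma A3_hom_torsion (R : realType) v n :
  (0 < n)%N -> A3_hom v ^+ n = 1 -> v = 1.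
Proof.
move=> n0; rewrite -(gmorphX _ A3_homM) -(gmorph1 A3_homM) => /(A3_hom_inj R) vn.
apply/matrixP => i j; have := lattice_expgE v n i j.
rewrite vn => /esym/eqP; rewrite [X in _ == X]mxE mulrn_eq0 eqn0Ngt n0 /=.
by move/eqP => ->; rewrite mxE.
Qed.

Lemma cycle_perm12P s : reflect (s = 1 \/ s = perm12) (s \in <[perm12]>).
Proof.
apply: (iffP idP) => [/cycleP[n ->]|[->|->]]; [|exact: group1|exact: cycle_id].
have p2 : perm12 ^+ 2 = 1 by rewrite expgS expg1 tperm2.
rewrite -(odd_double_half n) expgD -mul2n expgM p2 expg1n mulg1.
by case: (odd n); [right; rewrite expg1|left].
Qed.

Lemma sigmaQ_perm12P q :
  reflect ((exists v, q = A3_hom v) \/ exists v, q = A3_hom v * S1)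
          (sigmaQ q \in <[perm12]>).
Proof.
apply: (iffP (cycle_perm12P _)).
  case=> [/A3_hom_ex[v ->]|qE]; first by left; exists v.
  right; apply: sigmaQ_eq; by rewrite qE sigmaQ_S1.
case=> [[v ->]|[v ->]]; first by left; rewrite sigmaQ_A3_hom.
by right; rewrite sigmaQM sigmaQ_A3_hom sigmaQ_S1 mul1g.
Qed.

Lemma Htilde_torsion_free (R : realType) (H : {group 'S_3}) :
  H \subset <[perm12]> -> torsion_free (Htilde H).
Proof.
move=> /fintype.subsetP sH q n; rewrite HtildeE => /sH.
move=> /sigmaQ_perm12P[[v ->]|[v ->]] n0 qn.
  by rewrite (A3_hom_torsion R n0 qn) (gmorph1 A3_homM).
(* Over the transposition, the square of an element is a lattice vector whose first coordinate is
   the odd number 2 v_0 + 1, so it has infinite order. *)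
have q2 : (A3_hom v * S1) ^+ 2 =
    A3_hom (v * perm_lattice (tperm 1 2)%R v * Zbasis 0%R).
  rewrite !A3_homM A3_hom_basis [A3 _]A12E expg2.
  by rewrite -!mulgA (mulgA S1) S1_A3_hom -mulgA.
have /(A3_hom_torsion R n0)/matrixP/(_ 0 0)%R :
    A3_hom (v * perm_lattice (tperm 1 2)%R v * Zbasis 0%R) ^+ n = 1.
  by rewrite -q2 -expgnA mulnC expgnA qn expg1n.
rewrite !mxE tpermD //= => v0.
have {v0} : ((v : 'cV[int]_3) 0%R 0%R + (v : 'cV[int]_3) 0 0 + 1 = 0)%R by [].
by lia.
Qed.

Lemma Htilde_holonomy (R : realType) (H : {group 'S_3}) :
  H :=: <[perm12]> -> has_holonomy 3 (Htilde H) 'Z_2.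
Proof.
(* The group law of ['Z_2] is addition: [1] is here the class of 0, and [Zp1] the nontrivial
   element. *)
move=> HE; pose p (q : B3Q) : 'Z_2 := if sigmaQ q == 1 then 1 else Zp1.
have p12 : perm12 != 1.
  apply/eqP => /permP/(_ 0%R); rewrite permE perm1 /= => /eqP.
  by [].
have S1_H : S1 \in Htilde H by rewrite HtildeE sigmaQ_S1 HE cycle_id.
exists A3_hom, p; split.
- by split; [exact: A3_hom_inj R|exact: A3_homM].
- move=> q r; rewrite !HtildeE HE => /cycle_perm12P Hq /cycle_perm12P Hr.
  rewrite /p sigmaQM; move: Hq Hr => [->|->] [->|->];
    by rewrite ?mulg1 ?mul1g ?tperm2 ?eqxx ?(negPf p12) ?mulg1 ?mul1g //; apply: val_inj.
- move=> c; have [c0|c1] := boolP (c == 0%R).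
    by exists 1; rewrite ?gpred1 // /p (gmorph1 sigmaQM) eqxx (eqP c0).
  exists S1 => //; rewrite /p sigmaQ_S1 (negPf p12).
  by apply: val_inj; case: c c1 => [[|[|]]].
- move=> x; split=> [[Hx]|[u ->]].
    rewrite /p; case: eqP => [/A3_hom_ex//|_ /(congr1 val)//].
  by rewrite A3_hom_Htilde /p sigmaQ_A3_hom eqxx.
- move=> x; rewrite HtildeE HE => /sigmaQ_perm12P[[v ->] _|[v -> xc]].
    by rewrite /p sigmaQ_A3_hom eqxx.
  (* An element over the transposition conjugates [A23] to [A13], so it cannot centralize the
     lattice. *)
  have := xc (Zbasis 1%R); rewrite A3_hom_basis.
  rewrite -(mulgA _ S1) S1_A23 mulgA invgM mulgA mulgK.
  rewrite -[A13]/(A3 2%R) -A3_hom_basis -A3_homM -(gmorphV A3_homM) -A3_homM.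
  rewrite -[A3 1%R]A3_hom_basis => /(A3_hom_inj R)/matrixP/(_ 1 0)%R.
  by rewrite !mxE /= addr0 subrr.
Qed.

(** * The cyclic extension of order three *)

Section CyclicExtension.
Variable R : realType.

(** The cube of [S1 * S2] is the full twist, the product of the three lattice generators, which
    [S1 * S2] permutes cyclically. Dividing by one of them makes the cube trivial and splits the
    extension. *)
Definition rot3 : B3Q := S1 * S2 * A12^-1.

Lemma sigmaQ_rot3 : sigmaQ rot3 = perm132.
Proof.
have -> : sigmaQ rot3 = sigmaQ S1 * sigmaQ S2.
  rewrite /rot3 !sigmaQM (gmorphV sigmaQM) (_ : sigmaQ A12 = 1) ?invg1 ?mulg1 //.
  exact: (sigmaQ_A3 0%R).
rewrite sigmaQ_S1 sigmaQ_S2 /perm132; apply/permP => i; rewrite !permM.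
by case: i => [[|[|[|//]]] ?]; rewrite !permE /= ?permE /=; apply/eqP.
Qed.

Lemma perm132_order : #[perm132] = 3%N.
Proof.
move: perm132 perm132E => p [p0 p2 p1].
apply: nt_prime_order => //.
  apply/permP => i; rewrite !expgS expg0 mulg1 !permM perm1.
  have /or3P : [|| i == 0%R, i == 1%R | i == 2%R] by case: i => [[|[|[|]]]].
  by case=> /eqP ->; rewrite ?p0 ?p1 ?p2 ?p0 ?p1 ?p2 ?p0 ?p1 ?p2.
by apply/eqP => /permP/(_ 0%R); rewrite p0 perm1 => /eqP.
Qed.

Definition action_lattice (v : Zlattice 3) : Zlattice 3 :=
  (action_mx *m (v : 'cV[int]_3))%R.

Lemma action_latticeE v :
  [/\ (action_lattice v : 'cV[int]_3) 0%R 0%R = (v : 'cV[int]_3) 2%R 0%R,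
      (action_lattice v : 'cV[int]_3) 1%R 0%R = (v : 'cV[int]_3) 0%R 0%R &
      (action_lattice v : 'cV[int]_3) 2%R 0%R = (v : 'cV[int]_3) 1%R 0%R].
Proof.
split; rewrite /action_lattice !mxE !big_ord_recl big_ord0 !mxE /=
  ?mul0r ?mul1r ?add0r ?addr0; congr (v _ _); exact: val_inj.
Qed.

Lemma rot3_A3_hom v : rot3 * A3_hom v = A3_hom (action_lattice v) * rot3.
Proof.
(* The factor [A12^-1] passes through the lattice, leaving conjugation by [S1 * S2]. *)
have rA (x : B3Q) : commute A12 x -> rot3 * x = S1 * S2 * x * A12^-1.
  by move=> Ax; rewrite /rot3 -!mulgA; do 2![congr (_ * _)];
    apply/commute_sym/commuteV/commute_sym.
have r12 : rot3 * A12 = A23 * rot3.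
  rewrite rA // /rot3 -(mulgA S1) S2_A12 mulgA S1_A13.
  by rewrite -!mulgA.
have r23 : rot3 * A23 = A13 * rot3.
  rewrite rA; last exact: A12_A23.
  by rewrite /rot3 -(mulgA S1) S2_A23 mulgA S1_A23 -!mulgA.
have r13 : rot3 * A13 = A12 * rot3.
  rewrite rA; last exact: A12_A13.
  by rewrite /rot3 -(mulgA S1) S2_A13 mulgA S1_A12 -!mulgA.
have [e0 e1 e2] := action_latticeE v.
rewrite !A3_homE e0 e1 e2; move: rot3 r12 r23 r13 {rA} => r r12 r23 r13.
rewrite !mulgA (zpow_conj _ r12) -!mulgA.
rewrite (mulgA r) (zpow_conj _ r23) -mulgA (zpow_conj _ r13) !mulgA.
congr (_ * _).
rewrite -mulgA -(zpow_commute _ _ A12_A13) mulgA.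
by rewrite -(zpow_commute _ _ A12_A23).
Qed.

Lemma rot3_cube : rot3 ^+ 3 = 1.
Proof.
pose t := S1 * S2.
have tV x y : t * x = y * t -> y^-1 * t = t * x^-1.
  by move=> txy; apply: (@mulgI _ y); rewrite mulKVg mulgA -txy mulgK.
have t12 : A23^-1 * t = t * A12^-1.
  by apply: tV; rewrite -mulgA S2_A12 mulgA S1_A13 -mulgA.
have t23 : A13^-1 * t = t * A23^-1.
  by apply: tV; rewrite -mulgA S2_A23 mulgA S1_A23 -mulgA.
have t13 : A12^-1 * t = t * A13^-1.
  by apply: tV; rewrite -mulgA S2_A13 mulgA S1_A12 -mulgA.
have t3 : t * t * t = A12 * A13 * A23.
  rewrite A13E A12E A23E /t !mulgA mulgVK -!mulgA; congr (_ * _).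
  by rewrite !mulgA -S_braid.
have rE : rot3 = t * A12^-1 by [].
rewrite rE !expgS expg0 mulg1 {rE tV}; move: t t12 t23 t13 t3 => t t12 t23 t13 t3.
(* The three factors [A12^-1] move right past two, one and no copies of [t], becoming [A23^-1],
   [A13^-1] and [A12^-1]. *)
rewrite !mulgA -(mulgA t _ t) t13 -mulgA -(mulgA (t * _)) !mulgA.
rewrite -(mulgA _ _ t) t13 !mulgA -(mulgA _ _ t) t23 !mulgA t3.
by rewrite mulgK mulgK mulgV.
Qed.

Definition rot3_hom (x : semidirect Z3_action) : B3Q :=
  A3_hom x.1 * rot3 ^+ x.2.

Lemma rot3X_A3_hom k v :
  rot3 ^+ k * A3_hom v = A3_hom (iter k action_lattice v) * rot3 ^+ k.
Proof.
elim: k => [|k IH] /=; first by rewrite mulg1 mul1g.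
by rewrite expgS -mulgA IH mulgA rot3_A3_hom -mulgA.
Qed.

Lemma rot3X_mod k : rot3 ^+ (k %% 3) = rot3 ^+ k.
Proof.
by rewrite [in RHS](divn_eq k 3) expgnDr mulnC expgnA rot3_cube expg1n mul1g.
Qed.

Lemma Z3_actE (k : 'Z_3) v : Z3_action k v = iter k action_lattice v.
Proof.
rewrite /= /Z3_act; elim: (k : nat) => [|n IH] /=.
  by rewrite expr0 mul1mx.
by rewrite exprS -mulmxE -mulmxA IH.
Qed.

Lemma rot3_homM : {morph rot3_hom : x y / x * y}.
Proof.
move=> [u k] [v l].
change (A3_hom (u * Z3_action k v) * rot3 ^+ ((k * l)%g : 'Z_3) =
  A3_hom u * rot3 ^+ k * (A3_hom v * rot3 ^+ l)).
rewrite A3_homM Z3_actE.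
rewrite -mulgA [in RHS]mulgA -(mulgA _ (rot3 ^+ k)) rot3X_A3_hom.
rewrite -!mulgA; congr (_ * (_ * _)).
by rewrite -expgnDr -[RHS]rot3X_mod.
Qed.

Lemma sigmaQ_rot3_hom x : sigmaQ (rot3_hom x) = perm132 ^+ x.2.
Proof.
by rewrite /rot3_hom sigmaQM sigmaQ_A3_hom mul1g (gmorphX _ sigmaQM) sigmaQ_rot3.
Qed.

(** The permutation has order 3 and so determines the exponent; cancelling it leaves the injective
    [A3_hom]. *)
Lemma rot3_hom_inj : injective rot3_hom.
Proof.
move=> [u k] [v l] E.
have kl : k = l.
  have /eqP := congr1 sigmaQ E; rewrite !sigmaQ_rot3_hom /=.
  rewrite eq_expg_mod_order perm132_order !modn_small ?ltn_ord // => /eqP.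
  exact: val_inj.
move: E; rewrite /rot3_hom kl /= => /mulIg/(A3_hom_inj R) ->.
by [].
Qed.

Lemma Htilde_cyclic (H : {group 'S_3}) q : H :=: <[perm132]> ->
  q \in Htilde H <-> exists x, q = rot3_hom x.
Proof.
move=> HE; rewrite HtildeE HE; split=> [/cycleP[n qE]|[x ->]]; last first.
  by rewrite sigmaQ_rot3_hom mem_cycle.
have [|v ->] := @sigmaQ_eq q (rot3 ^+ n).
  by rewrite (gmorphX _ sigmaQM) sigmaQ_rot3.
by exists (v, inZp n); rewrite /rot3_hom /= rot3X_mod.
Qed.

Lemma Htilde_semidirect (H : {group 'S_3}) : H :=: <[perm132]> ->
  exists f : B3Q -> semidirect Z3_action,
    is_isomorphism (Htilde H) predT f /\ forall i, f (A3 i) = (Zbasis i, 1).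
Proof.
move=> HE.
have [|f [fiso fK]] :=
    isomorphism_of_embedding rot3_homM rot3_hom_inj (A := Htilde H).
  by move=> q; exact: Htilde_cyclic.
exists f; split=> // i; rewrite -[RHS]fK; congr f.
by rewrite /rot3_hom /= A3_hom_basis mulg1.
Qed.

End CyclicExtension.

(** * Topology of the isometry group *)

Section MatrixContinuity.
Variable R : realType.
Local Open Scope ring_scope.

Lemma mx_continuous (T : topologicalType) m n (f : T -> 'M[R]_(m, n)) (x : T) :
  (forall i j, {for x, continuous (fun y => f y i j)}) -> {for x, continuous f}.
Proof.
move=> fc A [P xP sPA]; suff : nbhs x [set y | forall i j, P i j (f y i j)].
  by apply: (@filterS _ (nbhs x) _ _ (f @^-1` A)) => y Py; exact: sPA.
apply: filter_forall => i; apply: filter_forall => j.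
exact: fc (xP i j).
Qed.

Lemma entry_continuous (T : topologicalType) m n (f : T -> 'M[R]_(m, n)) (x : T)
  i j : {for x, continuous f} -> {for x, continuous (fun y => f y i j)}.
Proof.
move=> fc; apply: (@continuous_comp _ _ _ f (fun M : 'M[R]_(m, n) => M i j)) => //.
exact: coord_continuous.
Qed.

Lemma mulmx_continuous (T : topologicalType) m n p (f : T -> 'M[R]_(m, n))
    (g : T -> 'M[R]_(n, p)) (x : T) :
  {for x, continuous f} -> {for x, continuous g} ->
  {for x, continuous (fun y => f y *m g y)}.
Proof.
move=> fc gc; apply: mx_continuous => i j.
rewrite (_ : (fun _ => _) = fun y => \sum_k f y i k * g y k j); last first.
  by apply/funext => y; rewrite mxE.
apply: cvg_big => [|k _]; first exact: add_continuous.
by apply: cvgM; apply: entry_continuous.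
Qed.

End MatrixContinuity.

(** * Estimates for the maximum norm *)

Section MatrixNorm.
Variable R : realType.
Local Open Scope ring_scope.

Lemma le_entry_norm m n (M : 'M[R]_(m, n)) i j : `|M i j| <= `|M|.
Proof.
rewrite [leRHS]/Num.norm /= mx_normrE; apply/bigmax_geP; right => /=.
by exists (i, j).
Qed.

Lemma norm_le_entry m n (M : 'M[R]_(m, n)) (c : R) : 0 <= c ->
  (forall i j, `|M i j| <= c) -> `|M| <= c.
Proof.
by move=> c0 Mc; rewrite [leLHS]/Num.norm /= mx_normrE; apply/bigmax_leP; split.
Qed.

Lemma norm_mulmx_le m n p (A : 'M[R]_(m, n)) (B : 'M[R]_(n, p)) :
  `|A *m B| <= n%:R * `|A| * `|B|.
Proof.
apply: norm_le_entry => [|i j]; first by rewrite !mulr_ge0.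
rewrite mxE (le_trans (ler_norm_sum _ _ _)) //.
rewrite -mulrA mulr_natl -[n in _ *+ n]card_ord -sumr_const; apply: ler_sum => k _.
by rewrite normrM ler_pM // le_entry_norm.
Qed.

(** The columns of an orthogonal matrix have Euclidean length 1. *)
Lemma norm_lin_le1 d (g : eisom R d) : `|lin g| <= 1.
Proof.
apply: norm_le_entry => // i j.
have /matrixP/(_ j j) := lin_orth g; rewrite !mxE eqxx mulr1n (bigD1 i) //= mxE => E.
rewrite -(@ler_pXn2r _ 2) ?nnegrE // expr1n real_normK ?num_real // -E -expr2.
rewrite lerDl sumr_ge0 // => k _; rewrite mxE -expr2.
exact: sqr_ge0.
Qed.

End MatrixNorm.

(** * Compactness, discreteness and uniformity *)

Section EisomTopology.
Variables (R : realType) (d : nat).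
Local Open Scope ring_scope.

(** Neighbourhoods in the initial topology contain preimages of open sets, so a preimage of a
    cluster point of the pushed filter is a cluster point. *)
Lemma initial_compact (S : choiceType) (T : topologicalType) (f : S -> T)
    (K : set (initial_topology f)) :
  compact (f @` K) -> compact K.
Proof.
move=> cK F FF FK.
have FfK : (f @ F) (f @` K).
  by apply: (@filterS _ F _ K (f @^-1` (f @` K))) => // x Kx; exists x.
have [_ [[k Kk <-] clk]] := cK (f @ F) _ FfK.
exists k; split=> // A B FA [_ [[C oC <-] Ck sCB]].
have FfA : (f @ F) (f @` A).
  by apply: (@filterS _ F _ A (f @^-1` (f @` A))) => // x Ax; exists x.
have [_ [[a Aa <-] Ca]] := clk (f @` A) C FfA (open_nbhs_nbhs (conj oC Ck)).
by exists a; split=> //; exact: sCB.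
Qed.

Lemma tr_continuous : continuous (@tr R d).
Proof.
move=> g; apply: (@continuous_comp _ _ _ (@eisom_val R d) fst).
  exact: initial_continuous.
exact: cvg_fst.
Qed.

Lemma lin_continuous : continuous (@lin R d).
Proof.
move=> g; apply: (@continuous_comp _ _ _ (@eisom_val R d) snd).
  exact: initial_continuous.
exact: cvg_snd.
Qed.

(** The set corresponds to a box of vectors times the orthogonal matrices, a closed subset of the
    box [-1, 1]. Both boxes are handled as row vectors and carried back by the continuous [phi]. *)
Lemma compact_bounded_eisom (c : R) :
  compact [set g : eisom R d | forall i, `|tr g i 0| <= c].
Proof.
apply: initial_compact.
pose D1 := [set u : 'rV[R]_d | forall i, `[- c, c]%classic (u 0 i)].
pose D2 := [set w : 'rV[R]_(d * d) | forall i, `[-1, 1]%classic (w 0 i)].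
pose O := [set w : 'rV[R]_(d * d) | (vec_mx w)^T *m vec_mx w = 1%:M].
have vec_mxc : continuous (vec_mx : 'rV[R]_(d * d) -> 'M[R]_d).
  move=> w; apply: mx_continuous => i j.
  rewrite (_ : (fun _ => _) = fun w : 'rV[R]_(d * d) => w 0 (mxvec_index i j)).
    exact: coord_continuous.
  by apply/funext => ?; rewrite mxE.
have trmxc m n : continuous (trmx : 'M[R]_(m, n) -> 'M[R]_(n, m)).
  move=> w; apply: mx_continuous => i j.
  rewrite (_ : (fun _ => _) = fun w : 'M[R]_(m, n) => w j i).
    exact: coord_continuous.
  by apply/funext => ?; rewrite mxE.
have cD1 : compact D1.
  by apply: (@rV_compact _ _ (fun=> `[- c, c]%classic)) => i; exact: segment_compact.
have cD2 : compact D2.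
  by apply: (@rV_compact _ _ (fun=> `[-1 : R, 1]%classic)) => i; exact: segment_compact.
have clO : closed O.
  apply: (@closed_comp _ _ (fun w : 'rV[R]_(d * d) => (vec_mx w)^T *m vec_mx w)
     [set 1%:M]).
    move=> w _.
    apply: (@mulmx_continuous _ _ _ _ _ (fun w : 'rV[R]_(d * d) => (vec_mx w)^T));
      last exact: vec_mxc.
    apply: (@continuous_comp _ _ _ vec_mx trmx); first exact: vec_mxc.
    exact: trmxc.
  exact/accessible_closed_set1/hausdorff_accessible/norm_hausdorff.
have cD2O : compact (D2 `&` O) by exact: compact_closedI.
pose phi (p : 'rV[R]_d * 'rV[R]_(d * d)) : 'cV[R]_d * 'M[R]_d :=
  (p.1^T, vec_mx p.2).
have phic : continuous phi.
  move=> p.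
  have c1 : (fun q : 'rV[R]_d * 'rV[R]_(d * d) => q.1^T) @ p --> p.1^T.
    apply: (@continuous_comp _ _ _ fst trmx); [exact: cvg_fst|exact: trmxc].
  have c2 : (fun q : 'rV[R]_d * 'rV[R]_(d * d) => vec_mx q.2 : 'M[R]_d) @ p -->
      (vec_mx p.2 : 'M[R]_d).
    by apply: (@continuous_comp _ _ _ snd vec_mx); [exact: cvg_snd|exact: vec_mxc].
  exact: (cvg_pair c1 c2).
rewrite (_ : _ @` _ = phi @` (D1 `*` (D2 `&` O))).
  apply: continuous_compact; last exact: compact_setX.
  exact: continuous_subspaceT.
apply/seteqP; split=> [_ [g gc <-]|_ [[u w] [/= D1u [D2w Ow]] <-]].
  exists ((tr g)^T, mxvec (lin g)).
    split=> [i|]; first by rewrite /= mxE in_itv /= -ler_norml gc.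
    split=> [i|]; last by rewrite /O /= mxvecK lin_orth.
    case/mxvec_indexP: i => i j; rewrite mxvecE /= in_itv /= -ler_norml.
    by rewrite (le_trans (le_entry_norm _ _ _)) // norm_lin_le1.
  by rewrite /phi /= trmxK mxvecK /tr /lin; case: (eisom_val g).
have gP : (u^T, vec_mx w : 'M[R]_d).2^T *m (u^T, vec_mx w : 'M[R]_d).2 == 1%:M.
  exact/eqP.
exists (Isom gP) => //= i.
by have := D1u i; rewrite /tr /= mxE in_itv /= -ler_norml.
Qed.

Lemma uniform_of_translations (Gam : groupClosed (eisom R d)) :
    (forall z : 'cV[int]_d, transl (map_mx intr z) \in Gam) ->
  uniform_subgroup Gam.
Proof.
move=> Gz; rewrite /uniform_subgroup.
pose K := [set g : eisom R d | forall i, `|tr g i 0| <= d%:R].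
rewrite (_ : setT = (\pi_(quotient_topology (cosets Gam)))%qT @` K).
  apply: continuous_compact; last exact: compact_bounded_eisom.
  by apply: continuous_subspaceT; exact: pi_continuous.
apply/seteqP; split=> // q _.
pose g : eisom R d := generic_quotient.repr q.
(* As [tr g = lin g *m y], multiplying [g] by the translation by [z] gives translation part
   [lin g *m (y + z)], and the entries of [y + z] are fractional parts. *)
pose y := (lin g)^T *m tr g.
pose z : 'cV[int]_d := - \col_i Num.floor (y i 0).
exists (g * transl (map_mx intr z))%g.
  move=> i; rewrite trM tr_transl.
  rewrite -[tr g]mul1mx -(lin_orthC g) -mulmxA -mulmxDr -/y.
  rewrite (le_trans (le_entry_norm _ _ _)) // (le_trans (norm_mulmx_le _ _)) //.
  rewrite -mulrA ler_piMr // mulr_ile1 ?norm_lin_le1 //.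
  apply: norm_le_entry => // k l; rewrite !mxE ord1.
  rewrite intrN; set s := \sum_j _; have /andP[] := floor_itv s.
  rewrite intrD => fs sf; rewrite ger0_norm ?subr_ge0 //.
  by rewrite lerBlDl ltW.
rewrite -[q in RHS]reprK; apply/eqmodP; rewrite /= /same_coset.
by rewrite invgM -mulgA mulVg mulg1 gpredV.
Qed.

Lemma discrete_of_integral (Gam : groupClosed (eisom R d)) :
    (forall g, g \in Gam -> (forall i, 2 * tr g i 0 \is a Num.int) /\
                            (forall i j, lin g i j \is a Num.int)) ->
  discrete_subgroup Gam.
Proof.
move=> GamZ g Gg; split; first exact/mem_set.
have [gt gl] := GamZ g Gg.
(* Translation entries are spaced by 1/2 and linear entries by 1, so [U] meets the group only in
   [g]. *)
pose U := [set h : eisom R d | (forall i j, `|tr g i j - tr h i j| < 2^-1) /\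
                               (forall i j, `|lin g i j - lin h i j| < 1)].
exists U.
  have nbhs_entry m n (f : eisom R d -> 'M[R]_(m, n)) e : 0 < e -> continuous f ->
      nbhs g [set h | forall i j, `|f g i j - f h i j| < e].
    move=> e0 fc;
    apply: (fc g [set A : 'M[R]_(m, n) | forall i j, `|f g i j - A i j| < e]).
    exists (fun i j => [set x | `|f g i j - x| < e]) => //= i j.
    exact: (@nbhsx_ballx _ R^o).
  by apply: filterI; apply: nbhs_entry => //; [exact: tr_continuous|exact: lin_continuous].
apply/seteqP; split=> [h [[ht hl] Gh]|_ ->]; last first.
  by split=> //; split=> i j; rewrite subrr normr0.
have [htZ hlZ] := GamZ h Gh.
have intlt1 (x : R) : x \is a Num.int -> `|x| < 1 -> x = 0.
  move=> /intrP[k ->]; rewrite -intr_norm -[1]/(1%:~R) ltr_int => k1.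
  by have -> : k = 0 by lia.
apply/esym/eisomP; apply/matrixP => i j; apply/eqP; rewrite -subr_eq0; apply/eqP.
  rewrite ord1; have : 2 * (tr g i 0 - tr h i 0) = 0; last by lra.
  apply: intlt1; first by rewrite mulrBr rpredB.
  by rewrite normrM ger0_norm // mulrC -ltr_pdivlMr // mul1r; exact: ht.
by apply: intlt1 => //; rewrite rpredB.
Qed.

Lemma uniform_dense (Gam : groupClosed (eisom R d)) : uniform_subgroup Gam ->
  exists c, forall x : 'cV[R]_d, exists2 g, g \in Gam & `|tr g - x| <= c.
Proof.
move=> uG.
pose Q := quotient_topology (cosets Gam).
(* These are the cosets containing an isometry with translation part shorter than [n]. They form an
   increasing open cover, so by compactness one [N] serves all cosets. *)
pose P (n : nat) (q : Q) :=
  exists2 g, g \in Gam & `|tr (generic_quotient.repr q * g)%g| < n%:R.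
have piP n h : P n (\pi_Q%qT h) <-> exists2 g, g \in Gam & `|tr (h * g)%g| < n%:R.
  have : same_coset Gam h (generic_quotient.repr (\pi_Q%qT h)).
    by have /eqmodP : \pi_(cosets Gam)%qT h =
        \pi_(cosets Gam)%qT (generic_quotient.repr (\pi_Q%qT h)) by rewrite reprK.
  rewrite /same_coset; set k := generic_quotient.repr _ => Gk.
  split=> -[g Gg gn].
    exists (h^-1 * k * g)%g; first exact: gpredM.
    by rewrite !mulgA mulgV mul1g.
  exists ((h^-1 * k)^-1 * g)%g; first by rewrite gpredM ?gpredV.
  by rewrite -/k invgM invgK !mulgA mulgV mul1g.
have oP n : open (P n : set Q).
  suff : open [set h : eisom R d | exists2 g, g \in Gam & `|tr (h * g)%g| < n%:R].
    rewrite (_ : mkset _ = \pi_Q%qT @^-1` (P n)) //.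
    by apply/seteqP; split=> h /=; rewrite piP.
  rewrite openE => h [g Gg gn]; rewrite /interior /=.
  have cg : {for h, continuous (fun h : eisom R d => `|tr (h * g)%g|)}.
    apply: (@continuous_comp _ _ _ (fun h : eisom R d => tr (h * g)%g) Num.norm);
      last exact: norm_continuous.
    apply: (@cvgD _ _ _ (nbhs h) _ (@tr R d) (fun h => lin h *m tr g)).
      exact: tr_continuous.
    apply: (@mulmx_continuous _ _ _ _ _ (@lin R d) (fun=> tr g)); [exact: lin_continuous|].
    exact: (@cst_continuous _ _ (tr g) h).
  have cgn := cg [set x | x < n%:R] (open_nbhs_nbhs (conj (@open_lt R _) gn)).
  by apply: (@filterS _ (nbhs h) _ _ _ _ cgn) => k kn; exists g.
move: uG => /compact_near_coveringP/(_ nat \oo P _) [|N _ NP].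
  move=> q _.
  pose n0 := (Num.truncn `|tr (generic_quotient.repr q)|).+1.
  have qn0 : P n0 q by exists 1%g; rewrite ?gpred1 // mulg1 truncnS_gt.
  exists (P n0, [set n | (n0 <= n)%N]) => /=.
    split; first exact: open_nbhs_nbhs (conj (oP _) qn0).
    by exists n0.
  move=> [r n] /= [[g Gg gn0] n0n]; exists g => //.
  by rewrite (lt_le_trans gn0) // ler_nat.
exists N%:R => x.
(* In the coset of the translation by [- x], translation parts have the form [tr g - x]. *)
have /piP[g Gg] : P N (\pi_Q%qT (transl (- x))) by exact: (NP N (leqnn N)).
by rewrite trM tr_transl lin_transl mul1mx addrC => /ltW; exists g.
Qed.

End EisomTopology.

(** * Lattices of translations and affine diffeomorphisms *)

Section Translations.
Variable R : realType.
Local Open Scope ring_scope.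

(* Elements commuting with [L] move the points of an orbit of [L] by a bounded
   amount, and an affine displacement that is bounded on a coarsely dense set
   is constant. *)
Lemma commuting_translation d (L : {pred eisom R d}) (c : R) (g : eisom R d) :
    (forall x, exists2 h, h \in L & `|tr h - x| <= c) ->
    {in L, forall h, commute g h} ->
  lin g = 1%:M.
Proof.
move=> dense comm; pose B := lin g - 1%:M.
pose C := `|tr g| + d%:R * `|tr g| + d%:R * `|B| * c.
have BC (x : 'cV[R]_d) : `|B *m x| <= C.
  have [h Lh hx] := dense x.
  have /(congr1 (@tr _ _)) : (g * h)%g = (h * g)%g by exact: comm.
  rewrite !trM => E.
  (* Commutation expresses [B *m tr h] through [tr g] alone, up to [lin h]; the last term is the
     error of approximating [x] by [tr h]. *)
  have -> : B *m x = lin h *m tr g - tr g - B *m (tr h - x).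
    rewrite mulmxBr [B *m tr h]mulmxBl mul1mx.
    have -> : lin g *m tr h = tr h + lin h *m tr g - tr g by rewrite -E addrC addKr.
    by apply/matrixP => i j; rewrite !mxE; ring.
  rewrite (le_trans (ler_normB _ _)) // lerD //.
    rewrite (le_trans (ler_normB _ _)) // addrC lerD2l.
    rewrite (le_trans (norm_mulmx_le _ _)) // -mulrA ler_wpM2l //.
    by rewrite ler_piMl // norm_lin_le1.
  by rewrite (le_trans (norm_mulmx_le _ _)) // ler_wpM2l // mulr_ge0.
apply/eqP; rewrite -subr_eq0 -/B; apply/eqP/matrixP => i j; rewrite [RHS]mxE.
apply/eqP/negPn/negP => Bij.
(* At this vector, entry [i] of the value is [C + 1], beyond the bound. *)
have := BC (((C + 1) / B i j) *: delta_mx j 0).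
apply/negP; rewrite -ltNge; apply: lt_le_trans (le_entry_norm _ i 0).
have colB : (B *m delta_mx j 0 : 'cV[R]_d) i 0 = B i j by rewrite -colE [LHS]mxE.
rewrite -scalemxAr mxE colB mulfVK // ltr_normr.
by rewrite ltrDl ltr01.
Qed.

(** If a nonzero row [w] kills [a], the image of [a] is orthogonal to [w], and points far along [w]
    are not approximated; [t] makes the defect exceed the bound by 1. *)
Lemma dense_lattice_unit d (a : 'M[R]_d) (c : R) :
    (forall x : 'cV[R]_d, exists v : 'cV[R]_d, `|a *m v - x| <= c) ->
  a \in unitmx.
Proof.
move=> dense; rewrite unitmxE unitfE; apply/negP => /det0P[w w0 wa].
have w2 : 0 < (w *m w^T) 0 0.
  rewrite mxE; have [i wi] : exists i, w 0 i != 0 by exact/rV0Pn.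
  rewrite (bigD1 i) //= ltr_wpDr //.
    by apply: sumr_ge0 => k _; rewrite mxE -expr2 sqr_ge0.
  by rewrite mxE -expr2 lt_def sqrf_eq0 wi sqr_ge0.
pose C := d%:R * `|w| * c; pose t := (C + 1) / (w *m w^T) 0 0.
have [v vt] := dense (t *: w^T).
have : `|w *m (a *m v - t *: w^T)| <= C.
  by rewrite (le_trans (norm_mulmx_le _ _)) // ler_wpM2l // mulr_ge0.
apply/negP; rewrite -ltNge; apply: lt_le_trans (le_entry_norm _ 0 0).
rewrite mulmxBr mulmxA wa mul0mx sub0r -scalemxAr mxE normrN mxE.
by rewrite /t mulfVK ?gt_eqF // ltr_normr ltrDl ltr01.
Qed.

Lemma transl_inj d : injective (@transl R d).
Proof. by move=> v w /(congr1 (@tr _ _)). Qed.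

Lemma Zlattice3E (v : Zlattice 3) : v =
  (zpow (Zbasis 0) ((v : 'cV[int]_3) 0 0) * zpow (Zbasis 1%R) ((v : 'cV[int]_3) 1%R 0) *
   zpow (Zbasis 2) ((v : 'cV[int]_3) 2 0))%g.
Proof.
apply: (A3_hom_inj R); rewrite !A3_homM A3_homE.
have zX i n : A3_hom (zpow (Zbasis i) n) = zpow (A3 i) n.
  rewrite -A3_hom_basis.
  by case: n => k /=; rewrite ?(gmorphV A3_homM) (gmorphX _ A3_homM).
by rewrite !zX.
Qed.

(** The image is abelian and coarsely dense, so each element commutes with a coarsely dense set and
    is a translation. The columns of [a] are the images of the basis, and density makes [a]
    invertible. *)
Lemma lattice_translations (phi : Zlattice 3 -> eisom R 3) (c : R) :
    {morph phi : u v / (u * v)%g} ->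
    (forall x, exists v, `|tr (phi v) - x| <= c) ->
  exists2 a, a \in unitmx & forall v : 'cV[int]_3, phi v = transl (a *m map_mx intr v).
Proof.
move=> phiM dense.
have lin_phi v : lin (phi v) = 1%:M.
  apply: (@commuting_translation _ (fun g => `[< exists v, g = phi v >]) c).
    by move=> x; have [u ux] := dense x; exists (phi u) => //; apply/asboolP; exists u.
  move=> _ /asboolP[u ->]; rewrite /commute -!phiM; congr phi.
  exact: (@addrC 'cV[int]_3).
pose a : 'M[R]_3 := \matrix_(i, j) tr (phi (Zbasis j)) i 0.
have phiE (v : 'cV[int]_3) : phi v = transl (a *m map_mx intr v).
  rewrite [in LHS](Zlattice3E v) !phiM.
  have zX i n : phi (zpow (Zbasis i) n) = transl (n%:~R *: tr (phi (Zbasis i))).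
    rewrite -zpow_transl -lin1_transl //.
    by case: n => k /=; rewrite ?(gmorphV phiM) (gmorphX _ phiM).
  rewrite !zX -!translM; congr transl; apply/matrixP => i j.
  rewrite !mxE !big_ord_recl big_ord0 !mxE ord1 addr0 addrA.
  by congr (_ + _ + _); rewrite mulrC; congr (tr (phi (Zbasis _)) _ _ * (v _ _)%:~R);
    exact: val_inj.
exists a => //; apply: (@dense_lattice_unit _ a c) => x.
by have [v] := dense x; rewrite phiE; exists (map_mx intr v).
Qed.

End Translations.

(** * Affine maps between orbit spaces *)

Section AffineDiffeomorphism.
Variables (R : realType).
Local Open Scope ring_scope.

Lemma Ck_on_cst (V W : normedModType R) k U (w : W) : Ck_on k U (fun _ : V => w).
Proof.
elim: k w => [|k IH] w /=; first by move=> x _; exact: cst_continuous.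
split=> [x _|v]; first exact: differentiable_cst.
rewrite (_ : 'D_v _ = fun=> 0); first exact: IH.
by apply/funext => x; exact: derive_cst.
Qed.

(** The directional derivatives are the constants [P *m v]. *)
Lemma smooth_affine d (P : 'M[R]_d) (p : 'cV[R]_d) U :
  smooth_on U (fun x : 'cV[R]_d => P *m x + p).
Proof.
have Pc : continuous (mulmx P : 'cV[R]_d -> 'cV[R]_d).
  move=> x; apply: (@mulmx_continuous _ _ _ _ _ (fun=> P) id) => //.
  exact: (@cst_continuous _ _ P).
have PD x : differentiable (mulmx P : 'cV[R]_d -> 'cV[R]_d) x.
  exact: linear_differentiable.
have fD x : differentiable (fun x : 'cV[R]_d => P *m x + p) x.
  by apply: differentiableD => //; exact: differentiable_cst.
case=> [|k] /=.
  by move=> x _; exact: differentiable_continuous.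
split=> [x _ //|v]; rewrite (_ : 'D_v _ = fun=> P *m v); first exact: Ck_on_cst.
apply/funext => x.
rewrite (@deriveD _ _ _ (mulmx P) (cst p)); [|exact: diff_derivable..].
by rewrite derive_cst addr0 deriveE // diff_lin.
Qed.

Lemma affine_diffeomorphic d (Gam Gam' : groupClosed (eisom R d))
    (P : 'M[R]_d) (p : 'cV[R]_d) :
    P \in unitmx ->
    {in Gam, forall g, exists2 g', g' \in Gam' &
      forall x, P *m eact g x + p = eact g' (P *m x + p)} ->
    {in Gam', forall g', exists2 g, g \in Gam &
      forall x, P *m eact g x + p = eact g' (P *m x + p)} ->
  diffeomorphic Gam Gam'.
Proof.
move=> Pu GG' G'G.
pose al x := P *m x + p; pose be y := invmx P *m y + invmx P *m (- p).
have alK : cancel al be by move=> x; rewrite /be -mulmxDr addrK mulKmx.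
have beK : cancel be al by move=> y; rewrite /al mulmxDr !mulKVmx // addrNK.
(* An intertwining map sends orbits into orbits, so the class of its value does not depend on the
   representative. *)
have descend (G1 G2 : groupClosed (eisom R d)) (f : 'cV[R]_d -> 'cV[R]_d) :
    {in G1, forall g, exists2 g', g' \in G2 & forall x, f (eact g x) = eact g' (f x)} ->
    forall x, orbit_class G2 (f (generic_quotient.repr (orbit_class G1 x))) =
              orbit_class G2 (f x).
  move=> fG x; apply/eqmodP.
  have /eqmodP/asboolP[g Gg gx] :
      orbit_class G1 (generic_quotient.repr (orbit_class G1 x)) = orbit_class G1 x.
    exact: reprK.
  have [g' Gg' fg] := fG g Gg.
  by apply/asboolP; exists g' => //; rewrite -fg gx.
have alG := descend Gam Gam' al GG'.
have beG : forall x, orbit_class Gam (be (generic_quotient.repr (orbit_class Gam' x))) =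
              orbit_class Gam (be x).
  apply: descend => g' /G'G[g Gg gg']; exists g => // x.
  by rewrite -[x in LHS]beK -gg' alK.
exists (fun o => orbit_class Gam' (al (generic_quotient.repr o))),
       (fun o => orbit_class Gam (be (generic_quotient.repr o))).
have orbK (G1 : groupClosed (eisom R d)) (o : orbit_space G1) :
    orbit_class G1 (generic_quotient.repr o) = o by exact: reprK.
split.
- by move=> o; rewrite beG alK orbK.
- by move=> o; rewrite alG beK orbK.
- move=> x; exists setT, al; split=> //; [exact: openT|exact: smooth_affine].
- move=> x; exists setT, be; split=> //; [exact: openT|exact: smooth_affine].
Qed.

End AffineDiffeomorphism.

(** * Flat manifolds *)

Section Intertwining.
Variables (R : realType) (d : nat) (Gam : groupClosed (eisom R d)).
Variables (f : 'cV[R]_d -> 'cV[R]_d).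
Local Open Scope ring_scope.

(** These elements form a subgroup, so intertwining need only be checked on generators. *)
Definition intertwined : {pred eisom R d} :=
  fun g => `[< exists2 g', g' \in Gam & forall x, f (eact g x) = eact g' (f x) >].

Lemma intertwinedP g :
  reflect (exists2 g', g' \in Gam & forall x, f (eact g x) = eact g' (f x))
          (g \in intertwined).
Proof. exact: asboolP. Qed.

Fact intertwinedM : mulg_closed intertwined.
Proof.
move=> g h /intertwinedP[g' Gg' gE] /intertwinedP[h' Gh' hE].
by apply/intertwinedP; exists (g' * h')%g => [|x]; rewrite ?gpredM // !eactM gE hE.
Qed.
Fact intertwined1 : 1%g \in intertwined.
Proof. by apply/intertwinedP; exists 1%g => [|x]; rewrite ?gpred1 // !eact1. Qed.
Fact intertwinedV : invg_closed intertwined.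
Proof.
move=> g /intertwinedP[g' Gg' gE]; apply/intertwinedP.
exists g'^-1%g => [|x]; first by rewrite gpredV.
by rewrite -[x in RHS](eact1 x) -(mulgV g) eactM gE -eactM mulVg eact1.
Qed.

HB.instance Definition _ := isMulClosed.Build (eisom R d) intertwined intertwinedM.
HB.instance Definition _ := isMul1Closed.Build (eisom R d) intertwined intertwined1.
HB.instance Definition _ := isInvClosed.Build (eisom R d) intertwined intertwinedV.

Lemma gen_intertwined (S : set (eisom R d)) : {subset S <= intertwined} ->
  {subset gen_subgroup S <= intertwined}.
Proof. by move=> Sf g /gen_subgroupP; apply. Qed.

End Intertwining.

(** * Wolf presentations, rigidity and the model groups *)

Section Wolf.
Variable R : realType.
Local Open Scope ring_scope.

(* The last clause of [is_wolf_B2]. *)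
Definition wolf_presentation (Gam : {pred eisom R 3}) (a : 'M[R]_3)
    (e : eisom R 3) : Prop :=
  let t1 := transl (col 0%R a) in
  let t2 := transl (col 1%R a) in
  let t3 := transl (col 2%R a) in
  [/\ a \in unitmx, Gam =i gen_subgroup [set t1; t2; t3; e],
      (e ^+ 2 = t1)%g, (e * t2 * e^-1 = t2)%g &
      (e * t3 * e^-1 = t1 * t2 * t3^-1)%g].

Lemma conj_transl d (g : eisom R d) v :
  (g * transl v * g^-1)%g = transl (lin g *m v).
Proof.
apply: (@mulIg _ g); rewrite mulgVK; apply: eisomP.
  by rewrite !trM lin_transl tr_transl mul1mx addrC.
by rewrite !linM lin_transl mulmx1 mul1mx.
Qed.

(** Conjugating a translation by [e] applies [lin e] to its vector, so the relations prescribe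
    [lin e] on a basis and constrain [tr e]. *)
Lemma wolf_linear Gam a e : wolf_presentation Gam a e ->
  [/\ lin e *m col 0 a = col 0 a, lin e *m col 1 a = col 1 a,
      lin e *m col 2 a = col 0 a + col 1 a - col 2 a &
      tr e + lin e *m tr e = col 0 a].
Proof.
move=> [_ _ e2 e3 e4]; split.
- apply: transl_inj; rewrite -conj_transl -e2 expg2.
  by rewrite mulgA mulgK.
- by apply: transl_inj; rewrite -conj_transl.
- by apply: transl_inj; rewrite -conj_transl e4 !translM translN.
- by have := congr1 (@tr _ _) e2; rewrite expg2 trM tr_transl.
Qed.

Lemma col_ord3_eq (A B : 'M[R]_3) : col 0 A = col 0 B -> col 1 A = col 1 B ->
  col 2 A = col 2 B -> A = B.
Proof.
move=> c0 c1 c2; apply/matrixP => i j.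
have E k : col k A = col k B -> A i k = B i k.
  by move=> /matrixP/(_ i 0); rewrite !mxE.
have /or3P : [|| j == 0%R, j == 1%R | j == 2%R] by case: j => [[|[|[|]]]].
by case=> /eqP ->; apply: E.
Qed.

Lemma eact_transl d (v x : 'cV[R]_d) : eact (transl v) x = x + v.
Proof. by rewrite /eact lin_transl mul1mx. Qed.

(** The linear map [P] matching the two lattice bases intertwines the linear parts of [e1] and [e2],
    which have the same matrix in these bases. A translation by [p] then aligns the glide
    reflections. *)
Lemma wolf_diffeomorphic (Gam1 Gam2 : groupClosed (eisom R 3)) a1 e1 a2 e2 :
  wolf_presentation Gam1 a1 e1 -> wolf_presentation Gam2 a2 e2 ->
  diffeomorphic Gam1 Gam2.
Proof.
move=> W1 W2.
have [E10 E11 E12 c1] := wolf_linear W1; have [E20 E21 E22 c2] := wolf_linear W2.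
have [a1u G1 _ _ _] := W1; have [a2u G2 _ _ _] := W2.
have [P [Pu Pcol]] : exists P, P \in unitmx /\ forall i, P *m col i a1 = col i a2.
  exists (a2 *m invmx a1); split=> [|i]; first by rewrite unitmx_mul a2u unitmx_inv.
  by rewrite !colE mulmxA mulmxKV.
have PE : P *m lin e1 = lin e2 *m P.
  suff : P *m lin e1 *m a1 = lin e2 *m P *m a1.
    by move=> /(congr1 (mulmx^~ (invmx a1))); rewrite !mulmxK.
  have colM (A B : 'M[R]_3) i : col i (A *m B) = A *m col i B.
    by rewrite !colE mulmxA.
  apply: col_ord3_eq; rewrite !colM -!mulmxA Pcol.
  - by rewrite E10 E20 Pcol.
  - by rewrite E11 E21 Pcol.
  - by rewrite E12 E22 mulmxBr mulmxDr !Pcol.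
(* Intertwining [e1] with [e2] requires [p - lin e2 *m p = D]; as [D] is a (-1)-eigenvector of
   [lin e2] or zero, half of it is a solution. *)
pose D := tr e2 - P *m tr e1; pose p := 2^-1 *: D.
have ED : lin e2 *m D = - D.
  rewrite mulmxBr mulmxA -PE -mulmxA.
  have -> : lin e2 *m tr e2 = col 0 a2 - tr e2 by rewrite -c2 addrC addKr.
  have -> : lin e1 *m tr e1 = col 0 a1 - tr e1 by rewrite -c1 addrC addKr.
  by rewrite mulmxBr Pcol /D; apply/matrixP => i j; rewrite !mxE; ring.
have eP x : P *m eact e1 x + p = eact e2 (P *m x + p).
  rewrite /eact !mulmxDr !mulmxA PE -!addrA; congr (_ + _).
  rewrite /p -scalemxAr ED.
  have -> : tr e2 = D + P *m tr e1 by rewrite subrK.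
  by apply/matrixP => i j; rewrite !mxE; lra.
have tP i x :
    P *m eact (transl (col i a1)) x + p = eact (transl (col i a2)) (P *m x + p).
  by rewrite !eact_transl mulmxDr Pcol addrAC.
have in2 i : i \in [:: 0; 1; 2] -> transl (col i a2) \in Gam2.
  rewrite !inE G2 => ii; apply/gen_subgroupP => K; apply; apply/mem_set.
  by case/or3P: ii => /eqP ->; [left; left; left|left; left; right|left; right].
have in1 i : i \in [:: 0; 1; 2] -> transl (col i a1) \in Gam1.
  rewrite !inE G1 => ii; apply/gen_subgroupP => K; apply; apply/mem_set.
  by case/or3P: ii => /eqP ->; [left; left; left|left; left; right|left; right].
have ine2 : e2 \in Gam2.
  by rewrite G2; apply/gen_subgroupP => K; apply; apply/mem_set; right.
have ine1 : e1 \in Gam1.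
  by rewrite G1; apply/gen_subgroupP => K; apply; apply/mem_set; right.
apply: (affine_diffeomorphic Pu (p := p)).
  move=> g; rewrite G1 => Gg.
  apply/(intertwinedP Gam2 (fun x => P *m x + p) g); move: g Gg.
  apply: gen_intertwined => g /set_mem gS; apply/intertwinedP.
  case: gS => [[[->|->]|->]|->].
  - by exists (transl (col 0 a2)); rewrite ?in2.
  - by exists (transl (col 1 a2)); rewrite ?in2.
  - by exists (transl (col 2 a2)); rewrite ?in2.
  - by exists e2.
pose be y := invmx P *m (y - p).
have beK y : P *m be y + p = y by rewrite /be mulKVmx // subrK.
have alK x : be (P *m x + p) = x by rewrite /be addrK mulKmx.
move=> g; rewrite G2 => Gg.
suff /intertwinedP[g' Gg' g'E] : g \in intertwined Gam1 be.
  by exists g' => // x; rewrite -{1}[x]alK -g'E beK.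
move: g Gg; apply: gen_intertwined => g /set_mem gS; apply/intertwinedP.
case: gS => [[[->|->]|->]|->].
- by exists (transl (col 0 a1)) => [|y]; rewrite ?in1 // -{1}[y]beK -tP alK.
- by exists (transl (col 1 a1)) => [|y]; rewrite ?in1 // -{1}[y]beK -tP alK.
- by exists (transl (col 2 a1)) => [|y]; rewrite ?in1 // -{1}[y]beK -tP alK.
- by exists e1 => // y; rewrite -{1}[y]beK -eP alK.
Qed.

Lemma torus_diffeomorphic (H : {group 'S_3}) (Gam : groupClosed (eisom R 3)) :
    H :=: 1%g -> uniform_subgroup Gam -> isomorphic (Htilde H) Gam ->
  diffeomorphic Gam (torus_group R 3).
Proof.
move=> HE uG [f [fM [fG finj fsurj]]].
pose phi v := f (A3_hom v).
have phiM : {morph phi : u v / (u * v)%g}.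
  by move=> u v; rewrite /phi A3_homM fM // A3_hom_Htilde.
have phi_ex g : g \in Gam -> exists v, g = phi v.
  move=> /fsurj[q Hq <-]; move: Hq => /=; rewrite HtildeE HE => /set1gP/A3_hom_ex[v ->].
  by exists v.
have phiG v : phi v \in Gam by apply: fG; exact: A3_hom_Htilde.
have [c dense] := uniform_dense uG.
have [|a au aE] := lattice_translations (c := c) phiM.
  by move=> x; have [g /phi_ex[v ->]] := dense x; exists v.
(* The lattice of [Gam] is [a] applied to Z^3, so [invmx a] carries it to the standard one. *)
apply: (@affine_diffeomorphic _ _ _ _ (invmx a) 0); first by rewrite unitmx_inv.
  move=> g /phi_ex[v ->]; exists (transl (map_mx intr v)).
    by apply/torus_groupP; split=> // i; rewrite tr_transl mxE intr_int.
  by move=> x; rewrite !addr0 aE !eact_transl mulmxDr mulKmx.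
move=> g /torus_groupP[g1 gZ].
pose v : 'cV[int]_3 := \col_i Num.floor (tr g i 0).
have vE : map_mx intr v = tr g.
  by apply/matrixP => i j; rewrite !mxE ord1; apply/eqP; rewrite -intrEfloor.
exists (phi v); first exact: phiG.
by move=> x; rewrite !addr0 aE vE (lin1_transl g1) !eact_transl mulmxDr mulKmx.
Qed.

(** The columns are the vectors of t_1, t_2, t_3 in the basis (A12, A23, A13): A12, A23 + A13 - A12
    and A23. With [S1] as the glide, which exchanges A23 and A13, they satisfy Wolf's relations. *)
Definition wolf_mx : 'M[int]_3 :=
  \matrix_(i < 3, j < 3)
    nth 0 (nth [::] [:: [:: 1; -1; 0]; [:: 0; 1; 1]; [:: 0; 1; 0]] i) j.

(** Its integrality shows that t_1, t_2, t_3 again form a basis of Z^3. *)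
Definition wolf_mx_inv : 'M[int]_3 :=
  \matrix_(i < 3, j < 3)
    nth 0 (nth [::] [:: [:: 1; 0; 1]; [:: 0; 0; 1]; [:: 0; 1; -1]] i) j.

Lemma wolf_mx_unit : map_mx intr wolf_mx \in @unitmx R 3.
Proof.
suff E : wolf_mx *m wolf_mx_inv = 1%:M.
  by apply: (@mulmx1_unit _ _ _ (map_mx intr wolf_mx_inv) _).1; rewrite -map_mxM E map_mx1.
apply/matrixP => i j; rewrite !(mxE, big_ord_recl, big_ord0).
by case: i => [[|[|[|//]]] ?]; case: j => [[|[|[|//]]] ?].
Qed.

Lemma zpow_closed (G : groupType) (A : groupClosed G) x n :
  x \in A -> zpow x n \in A.
Proof. by move=> Ax; case: n => k /=; rewrite ?gpredV gpredXn. Qed.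

Lemma Htilde_wolf_presentation (H : {group 'S_3}) (Gam : groupClosed (eisom R 3)) :
    H :=: <[perm12]>%g -> uniform_subgroup Gam -> isomorphic (Htilde H) Gam ->
  exists a e, wolf_presentation Gam a e.
Proof.
move=> HE uG [f [fM [fG finj fsurj]]].
pose phi v := f (A3_hom v); pose e := f S1.
have S1H : S1 \in Htilde H by rewrite HtildeE sigmaQ_S1 HE cycle_id.
have AH v : A3_hom v \in Htilde H by exact: A3_hom_Htilde.
have phiM : {morph phi : u v / (u * v)%g} by move=> u v; rewrite /phi A3_homM fM.
have phi_ex g : g \in Gam -> (exists v, g = phi v) \/ exists v, g = (phi v * e)%g.
  move=> /fsurj[q Hq <-]; move: Hq => /=; rewrite HtildeE HE.
  move=> /sigmaQ_perm12P[[v ->]|[v ->]]; first by left; exists v.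
  by right; exists v; rewrite fM.
have phiG v : phi v \in Gam by apply: fG; exact: AH.
have eG : e \in Gam by apply: fG; exact: S1H.
have ephi v : (e * phi v * e^-1)%g = phi (perm_lattice (tperm 1 2) v).
  by apply: (@mulIg _ e); rewrite mulgVK /e /phi -!fM // S1_A3_hom.
have e2 : (e ^+ 2)%g = phi (Zbasis 0).
  by rewrite expg2 /e /phi -fM // A3_hom_basis -A12E.
have [c dense] := uniform_dense uG.
(* The lattice has index 2; passing from [phi v * e] to [phi v] changes the translation part by at
   most [3 * |tr e|], so the lattice alone is still coarsely dense. *)
have [|a au aE] := lattice_translations (c := c + 3%:R * `|tr e|) phiM.
  move=> x; have [g /phi_ex[[v ->]|[v ->]] gx] := dense x; exists v.
    by rewrite (le_trans gx) // lerDl mulr_ge0.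
  have -> : tr (phi v) - x = tr (phi v * e)%g - x - lin (phi v) *m tr e.
    by rewrite trM; apply/matrixP => i j; rewrite !mxE; ring.
  rewrite (le_trans (ler_normB _ _)) // lerD // (le_trans (norm_mulmx_le _ _)) //.
  by rewrite -mulrA ler_wpM2l // ler_piMl // norm_lin_le1.
pose u2 : Zlattice 3 := (Zbasis 1%R * Zbasis 2 * (Zbasis 0)^-1)%g.
have colU : [/\ col 0 wolf_mx = Zbasis 0, col 1 wolf_mx = u2 & col 2 wolf_mx = Zbasis 1].
  split; apply/matrixP => i j; rewrite !mxE ord1;
    by case: i => [[|[|[|//]]] ?].
have tE i : transl (col i (a *m map_mx intr wolf_mx)) = phi (col i wolf_mx).
  rewrite aE; congr transl; rewrite !colE map_mxM mulmxA; congr (_ *m _).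
  by apply/matrixP => k l; rewrite !mxE; case: (_ && _).
have [U0 U1 U2] := colU.
exists (a *m map_mx intr wolf_mx), e; rewrite /wolf_presentation !tE U0 U1 U2.
split=> //.
- by rewrite unitmx_mul au wolf_mx_unit.
- set S := (X in gen_subgroup X).
  move=> g; apply/idP/idP => [Gg|/gen_subgroupP]; last first.
    by apply=> _ /set_mem[[[->|->]|->]|->].
  have gS s : S s -> s \in gen_subgroup S.
    by move=> Ss; apply/gen_subgroupP => K; apply; apply/mem_set.
  have g1 : phi (Zbasis 0) \in gen_subgroup S by apply: gS; left; left; left.
  have g2 : phi u2 \in gen_subgroup S by apply: gS; left; left; right.
  have g3 : phi (Zbasis 1%R) \in gen_subgroup S by apply: gS; left; right.
  have ge : e \in gen_subgroup S by apply: gS; right.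
  have g2' : phi (Zbasis 2) \in gen_subgroup S.
    (* A13 is recovered as t_2 t_1 t_3^-1, so t_1, t_2, t_3 generate the whole lattice. *)
    have -> : Zbasis 2 = (u2 * Zbasis 0 * (Zbasis 1%R)^-1)%g.
      rewrite /u2 mulgVK; apply: (@mulIg _ (Zbasis 1%R)); rewrite mulgVK.
      exact: (@addrC 'cV[int]_3).
    by rewrite 2!phiM (gmorphV phiM); apply: gpredM; [exact: gpredM|rewrite gpredV].
  have gphi v : phi v \in gen_subgroup S.
    have zX i n : phi (zpow (Zbasis i) n) = zpow (phi (Zbasis i)) n.
      by case: n => k /=; rewrite ?(gmorphV phiM) (gmorphX _ phiM).
    by rewrite (Zlattice3E R v) !phiM !zX; do 2?[apply: gpredM]; exact: zpow_closed.
  by have [[v ->]|[v ->]] := phi_ex g Gg; rewrite ?gpredM.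
- rewrite ephi; congr phi; apply/matrixP => i j; rewrite !mxE ord1.
  by case: i => [[|[|[|//]]] ?]; rewrite ?permE.
- rewrite ephi -(gmorphV phiM) -!phiM; congr phi; apply/matrixP => i j; rewrite !mxE ord1.
  by case: i => [[|[|[|//]]] ?]; rewrite ?permE.
Qed.

Lemma crystal_discrete (H : {group 'S_3}) : discrete_subgroup (crystal H R).
Proof.
apply: discrete_of_integral => g /crystalP[q _ ->].
have lP p i j : lin (rhoQ R p) i j \is a Num.int.
  by rewrite lin_rhoQ !mxE rpred_nat.
split=> //; have [v [t [tr_t ->]]] := normal_form_ex q.
(* Linear parts are integral, so products preserve half-integral translation parts; it remains to
   treat the lattice, [S1] and [S2]. *)
have KM p r : (forall i, 2 * tr (rhoQ R p) i 0 \is a Num.int) ->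
    (forall i, 2 * tr (rhoQ R r) i 0 \is a Num.int) ->
    (forall i, 2 * tr (rhoQ R (p * r)%g) i 0 \is a Num.int).
  move=> pZ rZ i; rewrite rhoQM trM mxE mulrDr rpredD // mxE mulr_sumr.
  by apply: rpred_sum => k _; rewrite mulrCA rpredM.
have K1 : forall i, 2 * tr (rhoQ R S1) i 0 \is a Num.int.
  move=> i; rewrite rhoQ_S1 tr_pisom mxE mulrA divff // mul1r mxE.
  by case: (_ && _).
have K2 : forall i, 2 * tr (rhoQ R S2) i 0 \is a Num.int.
  move=> i; rewrite rhoQ_S2 tr_pisom mxE mulrA divff // mul1r mxE.
  by case: (_ && _).
apply: (KM).
  by move=> i; rewrite rhoQ_A3_hom tr_transl mxE rpredM ?intr_int ?rpred_nat.
move: t tr_t; apply: coset_repsP => [|||||]; [|exact: K1|exact: K2|exact: KM|exact: KM|].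
  by move=> i; rewrite (gmorph1 (@rhoQM R)) tr1 mxE mulr0.
by apply: (KM) => //; exact: KM.
Qed.

Lemma crystal_uniform (H : {group 'S_3}) : uniform_subgroup (crystal H R).
Proof. by apply: uniform_of_translations => z; exact: transl_crystal. Qed.

Lemma crystal_flat (H : {group 'S_3}) : H \subset <[perm12]>%g ->
  flat_manifold_with_pi1 (Htilde H) (crystal H R).
Proof.
move=> sH; split; last exact: Htilde_crystal.
split; [exact: crystal_discrete|exact: crystal_uniform|].
exact: isomorphic_torsion_free (Htilde_crystal H R) (Htilde_torsion_free R sH).
Qed.

Lemma crystal_nonorientable (H : {group 'S_3}) : H :=: <[perm12]>%g ->
  ~ orientable (crystal H R).
Proof.
move=> HE /(_ (rhoQ R S1)) H0.
have : 0 < \det (lin (rhoQ R S1)).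
  by apply: H0; apply: rhoQ_crystal; rewrite HtildeE sigmaQ_S1 HE cycle_id.
by rewrite rhoQ_S1 lin_pisom det_perm odd_tperm /= expr1 ltr0N1.
Qed.

Lemma crystal_wolf (H : {group 'S_3}) : H :=: <[perm12]>%g ->
  is_wolf_B2 (crystal H R).
Proof.
move=> HE; have sH : H \subset <[perm12]>%g by rewrite HE.
have [flat iso] := crystal_flat sH.
split=> //; first exact: crystal_nonorientable.
  exact: isomorphic_holonomy iso (Htilde_holonomy R HE).
have [a [e W]] := Htilde_wolf_presentation HE (@crystal_uniform H) iso.
by exists a, e; exact: W.
Qed.

End Wolf.

Theorem theorem23 (R : realType) (H : {group 'S_3}) :
  (H :=: 1 ->
     [/\ isomorphic (Htilde H) P3Q,
         isomorphic P3Q (predT : {pred Zlattice 3}),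
         exists Gam : groupClosed (eisom R 3),
           flat_manifold_with_pi1 (Htilde H) Gam &
         forall Gam : groupClosed (eisom R 3),
           flat_manifold_with_pi1 (Htilde H) Gam ->
           diffeomorphic Gam (torus_group R 3)]) /\
  (H :=: <[perm12]> ->
     [/\ bieberbach R 3 (Htilde H),
         has_holonomy 3 (Htilde H) 'Z_2,
         exists Gam : groupClosed (eisom R 3), is_wolf_B2 Gam &
         forall Gam B2 : groupClosed (eisom R 3),
           flat_manifold_with_pi1 (Htilde H) Gam -> is_wolf_B2 B2 ->
           diffeomorphic Gam B2]) /\
  (H :=: <[perm132]> ->
     exists f : B3Q -> semidirect Z3_action,
       [/\ is_isomorphism (Htilde H) predT f,
           f A12 = (Zbasis 0%R, 1),
           f A23 = (Zbasis 1%R, 1) &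
           f A13 = (Zbasis 2%R, 1)]).
Proof.
split; [|split] => HE.
- have sH : H \subset <[perm12]> by rewrite HE sub1G.
  split.
  + exists id; split=> //.
    suff E q : (q \in Htilde H) = (q \in P3Q).
      split=> // [q Hq|q Pq]; first by rewrite /= -E.
      by exists q => //; rewrite /= E.
    by rewrite HtildeE P3QE HE; apply/set1gP/eqP.
  + exact: (P3Q_Zlattice R).
  + by eexists; exact: crystal_flat.
  + by move=> Gam [[_ uG _] iso]; exact: (torus_diffeomorphic HE).
- have sH : H \subset <[perm12]> by rewrite HE.
  have [[dG uG _] iso] := crystal_flat R sH.
  split.
  + split; last exact: (Htilde_torsion_free R sH).
    by eexists; split; [exact: dG|exact: uG|exact: iso].
  + exact: (Htilde_holonomy R HE).
  + by eexists; exact: crystal_wolf.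
  + move=> Gam B2 [[_ uGam _] isoGam] [_ _ _ [a2 [e2 W2]]].
    (* Both groups carry a Wolf presentation, which determines the quotient up to affine
       diffeomorphism. *)
    have [a1 [e1 W1]] := Htilde_wolf_presentation HE uGam isoGam.
    exact: wolf_diffeomorphic W1 W2.
- have [f [fiso fA]] := Htilde_semidirect R HE.
  by exists f; split=> //; [exact: (fA 0%R)|exact: (fA 1%R)|exact: (fA 2%R)].
Qed.
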